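(* Let $\rho\ge 0$ be a real number. The set $\mathbb{Z}\subseteq \mathscr{H}^\rho$ (integers regarded as constant functions) is positive existentially $\mathscr{L}_z$-definable in $\mathscr{H}^\rho$; that is, there is a positive existential $\mathscr{L}_z$-formula $\psi(t)$ in one free variable $t$ such that for every $f\in\mathscr{H}^\rho$, $\psi(f)$ holds in $\mathscr{H}^\rho$ if and only if $f\in\mathbb{Z}$.
   Context: $\mathscr{H}$ denotes the ring of entire functions $f:\mathbb{C}\to\mathbb{C}$ (holomorphic functions of one variable $z$ on $\mathbb{C}$). The order $\alpha(f)$ of $f\in\mathscr{H}$ is the infimum of all real numbers $\alpha\ge 0$ such that, as $r\to\infty$, $\log\max_{|z|\le r}|f(z)|\le O(r^\alpha)$; if no such $\alpha$ exists, $\alpha(f)=+\infty$. (The zero function has order $0$.) For a real number $\rho\ge 0$, $\mathscr{H}^\rho=\{f\in\mathscr{H}:\alpha(f)\le\rho\}$, which is a subring of $\mathscr{H}$ containing $\mathbb{C}[z]$. The language is $\mathscr{L}_z=\{0,1,z,+,\cdot,=\}$, and $\mathscr{H}^\rho$ is an $\mathscr{L}_z$-structure in the obvious way, the constant symbol $z$ being interpreted as the identity function $z\mapsto z$. A positive existential $\mathscr{L}_z$-formula is one of the form $\exists x_1\cdots\exists x_r\,\theta$ with $\theta$ built from atomic formulas (equalities of $\mathscr{L}_z$-terms) using only conjunctions and disjunctions (no negations). *)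

(* Defs.v *)
From Stdlib Require Import Reals Lra Lia List Classical.
From Stdlib Require Import FunctionalExtensionality ProofIrrelevance.
From Coquelicot Require Import Coquelicot.
Open Scope R_scope.

Definition entire (f : C -> C) : Prop := forall z : C, ex_derive f z.

(** The supremum is attained, hence is the maximum, when [f] is continuous and
    [0 <= r]. *)
Definition max_modulus (f : C -> C) (r : R) : R :=
  real (Lub_Rbar (fun m => exists z : C, Cmod z <= r /\ m = Cmod (f z))).

(** [ln] takes the value 0 on nonpositive reals, so the zero function satisfies
    the bound for every [alpha >= 0] and gets order 0. *)
Definition growth_exponent (f : C -> C) (alpha : R) : Prop :=
  0 <= alpha /\
  exists K : R, Rbar_locally p_infty
    (fun r => ln (max_modulus f r) <= K * Rpower r alpha).

(** [Glb_Rbar] is [p_infty] on the empty set. *)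
Definition order (f : C -> C) : Rbar := Glb_Rbar (growth_exponent f).

Definition in_H (rho : R) (f : C -> C) : Prop :=
  entire f /\ Rbar_le (order f) rho.

Record Lz_structure : Type := {
  carrier :> Type;
  zero_of : carrier;
  one_of : carrier;
  z_of : carrier;
  add_of : carrier -> carrier -> carrier;
  mul_of : carrier -> carrier -> carrier
}.

Inductive Lz_term : Type :=
| Var (x : nat)
| Zero
| One
| Zed
| Add (s t : Lz_term)
| Mul (s t : Lz_term).

Inductive pos_formula : Type :=
| Eq (s t : Lz_term)
| And (phi psi : pos_formula)
| Or (phi psi : pos_formula).

(** [Ex_prefix [x1; ...; xr] theta] is the formula "exists x1 ... xr, theta". *)
Inductive pe_formula : Type :=
| Ex_prefix (xs : list nat) (theta : pos_formula).

Fixpoint term_occurs (x : nat) (t : Lz_term) : Prop :=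
  match t with
  | Var y => x = y
  | Zero | One | Zed => False
  | Add s t | Mul s t => term_occurs x s \/ term_occurs x t
  end.

Fixpoint pos_occurs (x : nat) (phi : pos_formula) : Prop :=
  match phi with
  | Eq s t => term_occurs x s \/ term_occurs x t
  | And phi psi | Or phi psi => pos_occurs x phi \/ pos_occurs x psi
  end.

Definition free_in (x : nat) (psi : pe_formula) : Prop :=
  match psi with
  | Ex_prefix xs theta => pos_occurs x theta /\ ~ In x xs
  end.

Fixpoint term_val (M : Lz_structure) (v : nat -> M) (t : Lz_term) : M :=
  match t with
  | Var x => v x
  | Zero => zero_of M
  | One => one_of M
  | Zed => z_of M
  | Add s t => add_of M (term_val M v s) (term_val M v t)
  | Mul s t => mul_of M (term_val M v s) (term_val M v t)
  end.

Fixpoint pos_sat (M : Lz_structure) (v : nat -> M) (phi : pos_formula) : Prop :=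
  match phi with
  | Eq s t => term_val M v s = term_val M v t
  | And phi psi => pos_sat M v phi /\ pos_sat M v psi
  | Or phi psi => pos_sat M v phi \/ pos_sat M v psi
  end.

Definition update {A : Type} (v : nat -> A) (x : nat) (a : A) : nat -> A :=
  fun y => if Nat.eqb y x then a else v y.

Fixpoint ex_sat (M : Lz_structure) (v : nat -> M) (xs : list nat)
    (theta : pos_formula) : Prop :=
  match xs with
  | nil => pos_sat M v theta
  | x :: xs => exists a : M, ex_sat M (update v x a) xs theta
  end.

Definition pe_sat (M : Lz_structure) (v : nat -> M) (psi : pe_formula) : Prop :=
  match psi with Ex_prefix xs theta => ex_sat M v xs theta end.

(** [Var 0] plays the role of the free variable [t]; the values of [v] at other
    variables are irrelevant because these are not free in [psi]. *)
Definition pe_definable (M : Lz_structure) (S : M -> Prop) : Prop :=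
  exists psi : pe_formula,
    (forall x, free_in x psi -> x = 0%nat) /\
    forall v : nat -> M, pe_sat M v psi <-> S (v 0%nat).

Lemma entire_const (c : C) : entire (fun _ => c).
Proof. intro z. apply ex_derive_const. Qed.

Lemma entire_is_derive (f : C -> C) (z l : C) :
  @is_derive C_AbsRing C_NormedModule f z l <->
  @is_derive C_AbsRing (AbsRing_NormedModule C_AbsRing) f z l.
Proof.
split; intros [[H1 H2 H3] H4]; (split; [split; [exact H1|exact H2|exact H3]|exact H4]).
Qed.

Lemma entire_id : entire (fun z => z).
Proof.
intro z. exists (@one C_AbsRing). apply entire_is_derive.
apply (@is_derive_id C_AbsRing).
Qed.

Lemma entire_plus (f g : C -> C) :
  entire f -> entire g -> entire (fun z => Cplus (f z) (g z)).
Proof. intros Hf Hg z. apply (@ex_derive_plus C_AbsRing C_NormedModule); auto. Qed.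

Lemma entire_mult (f g : C -> C) :
  entire f -> entire g -> entire (fun z => Cmult (f z) (g z)).
Proof.
intros Hf Hg z. destruct (Hf z) as [df Df]. destruct (Hg z) as [dg Dg].
apply entire_is_derive in Df. apply entire_is_derive in Dg.
eexists. apply entire_is_derive.
apply (@is_derive_mult C_AbsRing f g z df dg Df Dg).
intros n m. apply Cmult_comm.
Qed.

Lemma entire_continuous (f : C -> C) : entire f ->
  forall (z : C) (eps : posreal), exists d : posreal,
  forall y : C, Cmod (y - z)%C < d -> Cmod (f y - f z)%C < eps.
Proof.
intros Hf z eps. destruct (Hf z) as [l Hl]. apply entire_is_derive in Hl.
assert (Hc : @continuous (AbsRing_UniformSpace C_AbsRing)
               (AbsRing_UniformSpace C_AbsRing) f z).
{ apply (@ex_derive_continuous C_AbsRing (AbsRing_NormedModule C_AbsRing)).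
  exists l; exact Hl. }
destruct (proj1 (@filterlim_locally (AbsRing_UniformSpace C_AbsRing)
  (AbsRing_UniformSpace C_AbsRing) _ _ f (f z)) Hc eps) as [d Hd].
exists d. intros y Hy. exact (Hd y Hy).
Qed.

Lemma Cmod_sub_abs (a b : C) : Rabs (Cmod a - Cmod b) <= Cmod (a - b)%C.
Proof.
apply Rabs_le_between.
assert (H1 := Cmod_triangle (a - b)%C b).
assert (H2 := Cmod_triangle (b - a)%C a).
replace (a - b + b)%C with a in H1 by ring.
replace (b - a + a)%C with b in H2 by ring.
replace (b - a)%C with (- (a - b))%C in H2 by ring.
rewrite Cmod_opp in H2. lra.
Qed.

Lemma entire_bounded (f : C -> C) (r : R) : entire f ->
  exists B : R, forall z : C, Cmod z <= r -> Cmod (f z) <= B.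
Proof.
intros Hf.
destruct (uniform_continuity_2d (fun x y => Cmod (f (x, y))) (-r) r (-r) r) with
  (eps := mkposreal 1 Rlt_0_1) as [d Hd].
{ intros x y _ _ eps.
  destruct (entire_continuous f Hf (x, y) eps) as [d Hd].
  assert (Hd2 : 0 < d / 2) by (destruct d; simpl; lra).
  exists (mkposreal _ Hd2). simpl. intros u v Hu Hv.
  eapply Rle_lt_trans; [apply Cmod_sub_abs|]. apply Hd.
  eapply Rle_lt_trans; [apply Cmod_2Rmax|]. simpl.
  assert (H2 : sqrt 2 < 2).
  { rewrite <- (sqrt_square 2) at 2 by lra. apply sqrt_lt_1; lra. }
  assert (Hm : Rmax (Rabs (u + - x)) (Rabs (v + - y)) < d / 2).
  { apply Rmax_lub_lt; assumption. }
  assert (Hm0 : 0 <= Rmax (Rabs (u + - x)) (Rabs (v + - y))).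
  { eapply Rle_trans; [apply Rabs_pos|apply Rmax_l]. }
  assert (H20 := sqrt_pos 2). nra. }
assert (Hd0 := cond_pos d).
destruct (Rle_or_lt 0 r) as [Hr|Hr].
2:{ exists 0. intros z Hz. assert (H := Cmod_ge_0 z). lra. }
destruct (nfloor_ex (r / d)) as [N [_ HN]].
{ apply Rmult_le_pos; [lra|]. left. apply Rinv_0_lt_compat, Hd0. }
set (n := S N).
assert (Hn : r < INR n * d).
{ unfold n. rewrite S_INR. apply Rmult_lt_reg_r with (/ d).
  now apply Rinv_0_lt_compat. rewrite Rmult_assoc, Rinv_r, Rmult_1_r; lra. }
assert (Hn0 : 0 < INR n) by (apply lt_0_INR; unfold n; lia).
exists (Cmod (f (0, 0)) + INR n). intros [x y] Hz.
assert (Hxy : Rabs x <= r /\ Rabs y <= r).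
{ assert (H := Rmax_Cmod (x, y)). simpl in H.
  assert (H1 := Rmax_l (Rabs x) (Rabs y)). assert (H2 := Rmax_r (Rabs x) (Rabs y)).
  lra. }
assert (Hstep : forall a, Rabs a <= r -> Rabs (a / INR n) < d).
{ intros a Ha. unfold Rdiv. rewrite Rabs_mult, (Rabs_right (/ INR n)).
  2:{ left. now apply Rinv_0_lt_compat. }
  apply Rmult_lt_reg_r with (INR n); [assumption|].
  rewrite Rmult_assoc, Rinv_l, Rmult_1_r; lra. }
assert (Hin : forall a k, Rabs a <= r -> (k <= n)%nat ->
  -r <= INR k * (a / INR n) <= r).
{ intros a k Ha Hk. apply Rabs_le_between.
  rewrite Rabs_mult. unfold Rdiv.
  rewrite Rabs_mult, (Rabs_right (/ INR n)), (Rabs_right (INR k)).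
  2:{ apply Rle_ge, pos_INR. }
  2:{ left. now apply Rinv_0_lt_compat. }
  apply le_INR in Hk. assert (H0 := pos_INR k).
  apply Rmult_le_reg_r with (INR n); [assumption|].
  replace (INR k * (Rabs a * / INR n) * INR n) with (INR k * Rabs a) by (field; lra).
  assert (Ha0 := Rabs_pos a). nra. }
assert (Hind : forall k, (k <= n)%nat ->
  Cmod (f (INR k * (x / INR n), INR k * (y / INR n))) <= Cmod (f (0, 0)) + INR k).
{ induction k as [|k IH]; intros Hk.
  { simpl. rewrite !Rmult_0_l. lra. }
  assert (Hk' : (k <= n)%nat) by lia. specialize (IH Hk').
  assert (H := Hd (INR k * (x / INR n)) (INR k * (y / INR n))
    (INR (S k) * (x / INR n)) (INR (S k) * (y / INR n))
    (Hin x k (proj1 Hxy) Hk') (Hin y k (proj2 Hxy) Hk')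
    (Hin x (S k) (proj1 Hxy) Hk) (Hin y (S k) (proj2 Hxy) Hk)).
  rewrite S_INR in *.
  assert (H' : Rabs (Cmod (f ((INR k + 1) * (x / INR n), (INR k + 1) * (y / INR n)))
    - Cmod (f (INR k * (x / INR n), INR k * (y / INR n)))) < 1).
  { apply H.
    - replace ((INR k + 1) * (x / INR n) - INR k * (x / INR n)) with (x / INR n) by ring.
      apply Hstep, Hxy.
    - replace ((INR k + 1) * (y / INR n) - INR k * (y / INR n)) with (y / INR n) by ring.
      apply Hstep, Hxy. }
  apply Rabs_def2 in H'. lra. }
assert (H := Hind n (le_n n)).
replace (INR n * (x / INR n)) with x in H by (field; lra).
replace (INR n * (y / INR n)) with y in H by (field; lra).
exact H.
Qed.

Lemma max_modulus_ub (f : C -> C) (r : R) (z : C) :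
  entire f -> Cmod z <= r -> Cmod (f z) <= max_modulus f r.
Proof.
intros Hf Hz. unfold max_modulus.
destruct (entire_bounded f r Hf) as [B HB].
set (E := fun m => _). destruct (Lub_Rbar_correct E) as [H1 H2].
assert (H3 := H1 (Cmod (f z)) (ex_intro _ z (conj Hz eq_refl))).
assert (H4 : Rbar_le (Lub_Rbar E) B).
{ apply H2. intros x [w [Hw ->]]. now apply HB. }
destruct (Lub_Rbar E); simpl in *; easy.
Qed.

Lemma max_modulus_le (f : C -> C) (r B : R) : 0 <= r ->
  (forall z, Cmod z <= r -> Cmod (f z) <= B) -> max_modulus f r <= B.
Proof.
intros Hr HB. unfold max_modulus.
set (E := fun m => _). destruct (Lub_Rbar_correct E) as [H1 H2].
assert (H0 : Cmod 0 <= r) by (rewrite Cmod_0; exact Hr).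
assert (H3 := H1 (Cmod (f 0)) (ex_intro _ (RtoC 0) (conj H0 eq_refl))).
assert (H4 : Rbar_le (Lub_Rbar E) B).
{ apply H2. intros x [w [Hw ->]]. now apply HB. }
destruct (Lub_Rbar E); simpl in *; easy.
Qed.

Lemma exp_le_exp (x y : R) : x <= y -> exp x <= exp y.
Proof. intros [Hxy| ->]; [left; now apply exp_increasing|apply Rle_refl]. Qed.

Lemma order_le_iff (f : C -> C) (rho : R) : 0 <= rho -> entire f ->
  Rbar_le (order f) rho <->
  forall alpha, rho < alpha -> exists K r0, 0 <= K /\ 1 <= r0 /\
    forall r z, r0 <= r -> Cmod z <= r ->
      Cmod (f z) <= exp (K * Rpower r alpha).
Proof.
intros Hrho Hf. unfold order.
destruct (Glb_Rbar_correct (growth_exponent f)) as [Hlb Hglb].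
split.
- intros Hle a Ha.
  assert (Hb : exists b, growth_exponent f b /\ b < a).
  { apply NNPP. intros Hno.
    assert (H : Rbar_le a (Glb_Rbar (growth_exponent f))).
    { apply Hglb. intros b Hb. simpl. apply Rnot_lt_le. intros Hba.
      apply Hno. now exists b. }
    assert (H' := Rbar_le_trans _ _ _ H Hle). simpl in H'. lra. }
  destruct Hb as [b [[Hb0 [K [r1 HK]]] Hba]].
  exists (Rmax K 0), (Rmax (r1 + 1) 1).
  split; [apply Rmax_r|split; [apply Rmax_r|]].
  intros r z Hr Hz.
  assert (Hr1 := Rmax_l (r1 + 1) 1). assert (Hr2 := Rmax_r (r1 + 1) 1).
  assert (Hr3 : r1 < r) by lra. specialize (HK r Hr3). clear Hr3.
  eapply Rle_trans; [apply (max_modulus_ub f r z Hf Hz)|].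
  destruct (Rlt_or_le 0 (max_modulus f r)) as [Hpos|Hneg].
  2:{ eapply Rle_trans; [exact Hneg|]. left. apply exp_pos. }
  rewrite <- (exp_ln _ Hpos) at 1.
  apply exp_le_exp. eapply Rle_trans; [exact HK|].
  assert (HP : Rpower r b <= Rpower r a) by (apply Rle_Rpower; lra).
  assert (HP0 : 0 < Rpower r b) by apply exp_pos.
  assert (HK1 := Rmax_l K 0). assert (HK2 := Rmax_r K 0). nra.
- intros H.
  assert (Hall : forall a, rho < a -> Rbar_le (Glb_Rbar (growth_exponent f)) a).
  { intros a Ha. apply Hlb. split; [lra|].
    destruct (H a Ha) as [K [r0 [HK [Hr0 HB]]]].
    exists K, r0. intros r Hr.
    assert (HM : max_modulus f r <= exp (K * Rpower r a)).
    { apply max_modulus_le; [lra|]. intros z Hz. apply HB; lra. }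
    destruct (Rlt_or_le 0 (max_modulus f r)) as [Hpos|Hneg].
    + assert (HL := ln_le _ _ Hpos HM). rewrite ln_exp in HL. exact HL.
    + unfold ln. destruct (Rlt_dec 0 (max_modulus f r)) as [Hp|_]; [exfalso; lra|].
      apply Rmult_le_pos; [exact HK|]. left. apply exp_pos. }
  destruct (Glb_Rbar (growth_exponent f)) as [g| |].
  + simpl in *. apply Rnot_lt_le. intros Hg.
    assert (Hlt : rho < (rho + g) / 2) by lra. specialize (Hall _ Hlt). lra.
  + exfalso. apply (Hall (rho + 1)). lra.
  + exact I.
Qed.

Lemma in_H_const (rho : R) (c : C) : 0 <= rho -> in_H rho (fun _ => c).
Proof.
intros Hrho. split; [apply entire_const|].
apply order_le_iff; [exact Hrho|apply entire_const|].
intros a Ha. exists (Cmod c), 1.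
split; [apply Cmod_ge_0|split; [lra|]]. intros r z Hr _.
assert (HP : 1 <= Rpower r a).
{ rewrite <- (Rpower_O r) by lra. apply Rle_Rpower; lra. }
assert (Hc := Cmod_ge_0 c). assert (He := exp_ineq1_le (Cmod c * Rpower r a)). nra.
Qed.

Lemma in_H_id (rho : R) : 0 <= rho -> in_H rho (fun z => z).
Proof.
intros Hrho. split; [apply entire_id|].
apply order_le_iff; [exact Hrho|apply entire_id|].
intros a Ha. exists (/ a), 1.
assert (Ha0 : 0 < a) by lra.
split; [left; now apply Rinv_0_lt_compat|split; [lra|]]. intros r z Hr Hz.
eapply Rle_trans; [exact Hz|]. rewrite <- (exp_ln r) at 1 by lra.
apply exp_le_exp.
assert (He := exp_ineq1_le (a * ln r)). fold (Rpower r a) in He.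
apply Rmult_le_reg_l with a; [exact Ha0|].
rewrite <- Rmult_assoc, Rinv_r, Rmult_1_l; lra.
Qed.

Lemma in_H_plus (rho : R) (f g : C -> C) : 0 <= rho ->
  in_H rho f -> in_H rho g -> in_H rho (fun z => Cplus (f z) (g z)).
Proof.
intros Hrho [Ef Of] [Eg Og]. assert (E := entire_plus f g Ef Eg).
split; [exact E|]. apply order_le_iff; [exact Hrho|exact E|].
intros a Ha.
destruct (proj1 (order_le_iff f rho Hrho Ef) Of a Ha) as [K1 [r1 [HK1 [Hr1 H1]]]].
destruct (proj1 (order_le_iff g rho Hrho Eg) Og a Ha) as [K2 [r2 [HK2 [Hr2 H2]]]].
exists (K1 + K2 + 1), (Rmax r1 r2).
assert (L1 := Rmax_l r1 r2). assert (L2 := Rmax_r r1 r2).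
split; [lra|split; [lra|]]. intros r z Hr Hz.
assert (B1 : Cmod (f z) <= exp (K1 * Rpower r a)) by (apply H1; lra).
assert (B2 : Cmod (g z) <= exp (K2 * Rpower r a)) by (apply H2; lra).
assert (HP : 1 <= Rpower r a).
{ rewrite <- (Rpower_O r) by lra. apply Rle_Rpower; lra. }
eapply Rle_trans; [apply Cmod_triangle|].
replace ((K1 + K2 + 1) * Rpower r a)
  with (K1 * Rpower r a + K2 * Rpower r a + Rpower r a) by ring.
rewrite !exp_plus.
assert (X1 : 1 <= exp (K1 * Rpower r a)).
{ rewrite <- exp_0. apply exp_le_exp. nra. }
assert (X2 : 1 <= exp (K2 * Rpower r a)).
{ rewrite <- exp_0. apply exp_le_exp. nra. }
assert (X3 : 2 <= exp (Rpower r a)).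
{ assert (He := exp_ineq1_le (Rpower r a)). lra. }
set (A := exp (K1 * Rpower r a)) in *. set (B := exp (K2 * Rpower r a)) in *.
set (D := exp (Rpower r a)) in *.
assert (HAB : A + B <= 2 * (A * B)) by nra.
assert (HABD : A * B * 2 <= A * B * D) by (apply Rmult_le_compat_l; nra).
lra.
Qed.

Lemma in_H_mult (rho : R) (f g : C -> C) : 0 <= rho ->
  in_H rho f -> in_H rho g -> in_H rho (fun z => Cmult (f z) (g z)).
Proof.
intros Hrho [Ef Of] [Eg Og]. assert (E := entire_mult f g Ef Eg).
split; [exact E|]. apply order_le_iff; [exact Hrho|exact E|].
intros a Ha.
destruct (proj1 (order_le_iff f rho Hrho Ef) Of a Ha) as [K1 [r1 [HK1 [Hr1 H1]]]].
destruct (proj1 (order_le_iff g rho Hrho Eg) Og a Ha) as [K2 [r2 [HK2 [Hr2 H2]]]].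
exists (K1 + K2), (Rmax r1 r2).
assert (L1 := Rmax_l r1 r2). assert (L2 := Rmax_r r1 r2).
split; [lra|split; [lra|]]. intros r z Hr Hz.
rewrite Cmod_mult, Rmult_plus_distr_r, exp_plus.
apply Rmult_le_compat; try apply Cmod_ge_0; [apply H1|apply H2]; lra.
Qed.

Definition H_struct (rho : R) (hrho : 0 <= rho) : Lz_structure := {|
  carrier := {f : C -> C | in_H rho f};
  zero_of := exist _ (fun _ => RtoC 0) (in_H_const rho 0 hrho);
  one_of := exist _ (fun _ => RtoC 1) (in_H_const rho 1 hrho);
  z_of := exist _ (fun z => z) (in_H_id rho hrho);
  add_of := fun f g => exist _ (fun z => Cplus (proj1_sig f z) (proj1_sig g z))
    (in_H_plus rho _ _ hrho (proj2_sig f) (proj2_sig g));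
  mul_of := fun f g => exist _ (fun z => Cmult (proj1_sig f z) (proj1_sig g z))
    (in_H_mult rho _ _ hrho (proj2_sig f) (proj2_sig g))
|}.

Lemma H_struct_eq (rho : R) (hrho : 0 <= rho) (f g : H_struct rho hrho) :
  f = g <-> forall z : C, proj1_sig f z = proj1_sig g z.
Proof.
split; [now intros ->|]. destruct f as [f pf], g as [g pg]. simpl. intros E.
assert (f = g) by now apply functional_extensionality. subst g.
f_equal. apply proof_irrelevance.
Qed.

Definition int_in_H (rho : R) (hrho : 0 <= rho) (n : Z) : H_struct rho hrho :=
  exist _ (fun _ => RtoC (IZR n)) (in_H_const rho (RtoC (IZR n)) hrho).

(* Main.v *)
(** A Pell-equation argument. Let [d > rho] and let [P] be the [d]-th Chebyshev polynomial. The
    formula says that [3t+1] and [3t+2] are units and that [X^2 - (P^2-1) V^2 = 1] has a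
    solution with [X = 1] and [V = 2tP] modulo [P^2-1]. The powers of the fundamental solution
    show that every integer [t] satisfies it.

    Conversely, a function [tau] of finite order such that [tau] and [tau-1] are units is
    constant, because its logarithmic derivatives are polynomials. Substituting [z = cosh s] turns
    [P] into [cosh (ds)], so [F(s) = X + sinh(ds) V] is an entire function of [s] with inverse
    [X - sinh(ds) V], and [log |F|] is [O(exp(alpha |Re s|))] for some [alpha < d]; hence so is
    [F'/F]. The congruences say that [F'/F - 2td = sinh(s) sinh(ds) E(cosh s)] with [E] entire.
    By growth and Liouville's theorem [E = 0], so [F = exp(2tds)]. At [s = i pi/d] this reads
    [1 = exp(2 pi i t)]. *)
From Stdlib Require Import ZArith Reals Lra Lia Psatz List Classical ClassicalEpsilon.
From Coquelicot Require Import Coquelicot.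
Require Import Defs.
Open Scope R_scope.

(** * Complex derivatives and integrals over the unit interval *)

(** The equation and the congruences alone cannot single out the integers: with R = P^2-1 and any
    constant t, the functions X = cosh(2tP sqrt R) and V = sinh(2tP sqrt R)/sqrt R are entire and
    satisfy all of them. For nonzero t their order is 2d, so only growth can exclude them, and the
    formula has to depend on rho through d. Since |cosh s| <= exp |Re s|, order below alpha in z
    bounds log |F| in terms of Re s alone, and the divisor sinh(s) sinh(ds) outgrows F'/F because
    alpha < d.

    The constancy of t has to be settled beforehand: F' = 2td F integrates to an exponential only
    for constant t. The units 3t+1 and 3t+2 differ by 1, as that argument requires, and vanish at no
    integer, whereas t and t-1 vanish at 0 and 1. The factor 2 in 2tP comes from squaring: the n-th
    power of P + sqrt R has first coordinate congruent to P^n modulo R, but its square has first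
    coordinate congruent to 1. *)

Notation CU := (AbsRing_UniformSpace C_AbsRing).
Notation ccont := (@continuous CU CU).
Notation rcont := (@continuous R_UniformSpace CU).

(** [entire] is stated over [C_NormedModule], while the product rule lives on the ring as a module
    over itself; [entire_is_derive] mediates between the two. *)
Definition cderiv (f : C -> C) (z l : C) : Prop :=
  @is_derive C_AbsRing (AbsRing_NormedModule C_AbsRing) f z l.

Lemma Cmod_le_components (z : C) (M : R) :
  Rabs (Re z) <= M -> Rabs (Im z) <= M -> Cmod z <= 2 * M.
Proof.
intros H1 H2. eapply Rle_trans; [apply Cmod_2Rmax|].
assert (Hs : sqrt 2 <= 2).
{ rewrite <- (sqrt_square 2) at 2 by lra. apply sqrt_le_1; lra. }
assert (H3 : Rmax (Rabs (fst z)) (Rabs (snd z)) <= M) by now apply Rmax_lub.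
assert (H4 := Rle_trans _ _ _ (Rabs_pos (fst z)) (Rmax_l _ (Rabs (snd z)))).
assert (H5 := sqrt_pos 2). nra.
Qed.

Lemma im_le_Cmod (z : C) : Rabs (Im z) <= Cmod z.
Proof. eapply Rle_trans; [|apply Rmax_Cmod]. apply Rmax_r. Qed.

Lemma Cmod_minus_sym (a b : C) : Cmod (a - b)%C = Cmod (b - a)%C.
Proof. rewrite <- Cmod_opp. f_equal. ring. Qed.

Lemma Cmod_minus_triangle (a b c : C) : Cmod (a - c)%C <= Cmod (a - b)%C + Cmod (b - c)%C.
Proof. replace (a - c)%C with (a - b + (b - c))%C by ring. apply Cmod_triangle. Qed.

Lemma ccont_eps {T : UniformSpace} (f : T -> C) (x : T) :
  @continuous T CU f x <->
  forall eps : posreal, locally x (fun y => Cmod (f y - f x)%C < eps).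
Proof.
unfold continuous. rewrite filterlim_locally. reflexivity.
Qed.

Lemma ccont_eps_C (f : C -> C) (z : C) :
  ccont f z <-> forall eps : posreal, exists d : posreal,
    forall w, Cmod (w - z)%C < d -> Cmod (f w - f z)%C < eps.
Proof. exact (ccont_eps (T := CU) f z). Qed.

Lemma cderiv_eps (f : C -> C) (z l : C) :
  cderiv f z l <-> forall eps : posreal, exists d : posreal, forall w,
    Cmod (w - z)%C < d -> Cmod (f w - f z - (w - z) * l)%C <= eps * Cmod (w - z)%C.
Proof.
split.
- intros [_ H] eps. exact (H z (fun P HP => HP) eps).
- intros H. split; [apply is_linear_scal_l|].
  intros y Hy eps.
  rewrite <- (@is_filter_lim_locally_unique C_AbsRing (AbsRing_NormedModule C_AbsRing) z y Hy).
  exact (H eps).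
Qed.

Lemma cderiv_ccont (f : C -> C) (z l : C) : cderiv f z l -> ccont f z.
Proof.
intros H. apply (@ex_derive_continuous C_AbsRing (AbsRing_NormedModule C_AbsRing)).
now exists l.
Qed.

Lemma cderiv_unique (f : C -> C) (z l1 l2 : C) :
  cderiv f z l1 -> cderiv f z l2 -> l1 = l2.
Proof.
intros H1 H2. rewrite cderiv_eps in H1, H2.
apply NNPP. intros Hne.
assert (Hpos : 0 < Cmod (l1 - l2)%C).
{ apply Cmod_gt_0. intros H0. apply Hne.
  replace l1 with (l1 - l2 + l2)%C by ring. rewrite H0. ring. }
assert (He : 0 < Cmod (l1 - l2)%C / 4) by lra.
destruct (H1 (mkposreal _ He)) as [d1 D1]. destruct (H2 (mkposreal _ He)) as [d2 D2].
set (d := Rmin d1 d2 / 2).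
assert (Hd : 0 < d /\ d < d1 /\ d < d2).
{ unfold d. assert (A := cond_pos d1). assert (B := cond_pos d2).
  assert (0 < Rmin d1 d2) by now apply Rmin_glb_lt.
  assert (A1 := Rmin_l d1 d2). assert (B1 := Rmin_r d1 d2). lra. }
assert (Hw : (z + d - z = d)%C) by ring.
assert (Hm : Cmod d = d) by (rewrite Cmod_R; apply Rabs_right; lra).
specialize (D1 (z + d)%C). specialize (D2 (z + d)%C).
rewrite Hw, Hm in D1, D2. simpl in D1, D2.
specialize (D1 (proj1 (proj2 Hd))). specialize (D2 (proj2 (proj2 Hd))).
set (u := (f (z + d)%C - f z - d * l1)%C) in *.
set (v := (f (z + d)%C - f z - d * l2)%C) in *.
assert (Huv : (d * (l1 - l2) = v - u)%C) by (unfold u, v; ring).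
assert (Hc : Cmod (d * (l1 - l2))%C = d * Cmod (l1 - l2)%C) by (rewrite Cmod_mult, Hm; ring).
rewrite Huv in Hc.
assert (Ht := Cmod_triangle v (- u)%C). rewrite Cmod_opp in Ht.
change (v + - u)%C with (v - u)%C in Ht. nra.
Qed.

Lemma cderiv_const (c z : C) : cderiv (fun _ => c) z 0.
Proof. apply (@is_derive_const C_AbsRing (AbsRing_NormedModule C_AbsRing)). Qed.

Lemma cderiv_id (z : C) : cderiv (fun z => z) z 1.
Proof. apply (@is_derive_id C_AbsRing). Qed.

Lemma cderiv_plus (f g : C -> C) (z a b : C) :
  cderiv f z a -> cderiv g z b -> cderiv (fun w => f w + g w)%C z (a + b)%C.
Proof. apply (@is_derive_plus C_AbsRing (AbsRing_NormedModule C_AbsRing)). Qed.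

Lemma cderiv_minus (f g : C -> C) (z a b : C) :
  cderiv f z a -> cderiv g z b -> cderiv (fun w => f w - g w)%C z (a - b)%C.
Proof. apply (@is_derive_minus C_AbsRing (AbsRing_NormedModule C_AbsRing)). Qed.

Lemma cderiv_mult (f g : C -> C) (z a b : C) :
  cderiv f z a -> cderiv g z b -> cderiv (fun w => f w * g w)%C z (a * g z + f z * b)%C.
Proof.
intros Hf Hg. apply (@is_derive_mult C_AbsRing f g z a b Hf Hg). exact Cmult_comm.
Qed.

Lemma cderiv_comp (f g : C -> C) (z a b : C) :
  cderiv f (g z) a -> cderiv g z b -> cderiv (fun w => f (g w)) z (b * a)%C.
Proof. apply (@is_derive_comp C_AbsRing (AbsRing_NormedModule C_AbsRing)). Qed.

Lemma cderiv_scal (c : C) (f : C -> C) (z a : C) :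
  cderiv f z a -> cderiv (fun w => c * f w)%C z (c * a)%C.
Proof.
intros H. replace (c * a)%C with (0 * f z + c * a)%C by ring.
apply (cderiv_mult (fun _ => c)); [apply cderiv_const|exact H].
Qed.

Lemma cderiv_eq (f : C -> C) (z a b : C) : cderiv f z a -> a = b -> cderiv f z b.
Proof. now intros H <-. Qed.

Lemma cderiv_ext (f g : C -> C) (z a : C) :
  (forall w, f w = g w) -> cderiv f z a -> cderiv g z a.
Proof. intros H. apply (@is_derive_ext C_AbsRing (AbsRing_NormedModule C_AbsRing)). exact H. Qed.

Lemma entire_cderiv (f : C -> C) : entire f <-> forall z, exists l, cderiv f z l.
Proof.
split; intros H z; destruct (H z) as [l Hl]; exists l; now apply entire_is_derive.
Qed.

Lemma entire_intro (f f' : C -> C) : (forall z, cderiv f z (f' z)) -> entire f.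
Proof. intros H. apply entire_cderiv. intros z. now exists (f' z). Qed.

Lemma entire_ccont (f : C -> C) (z : C) : entire f -> ccont f z.
Proof. intros H. apply entire_cderiv with (z := z) in H. destruct H as [l H].
exact (cderiv_ccont _ _ _ H). Qed.

Section Continuity.
Context {T : UniformSpace}.
Implicit Types f g : T -> C.

Lemma cont_const (c : C) (x : T) : @continuous T CU (fun _ => c) x.
Proof. apply (continuous_const (U := T) (V := CU)). Qed.

Lemma cont_plus f g x : @continuous T CU f x -> @continuous T CU g x ->
  @continuous T CU (fun y => f y + g y)%C x.
Proof. apply (@continuous_plus T C_AbsRing (AbsRing_NormedModule C_AbsRing)). Qed.

Lemma cont_minus f g x : @continuous T CU f x -> @continuous T CU g x ->
  @continuous T CU (fun y => f y - g y)%C x.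
Proof. apply (@continuous_minus T C_AbsRing (AbsRing_NormedModule C_AbsRing)). Qed.

Lemma cont_mult f g x : @continuous T CU f x -> @continuous T CU g x ->
  @continuous T CU (fun y => f y * g y)%C x.
Proof. apply (@continuous_mult T C_AbsRing). Qed.

Lemma cont_comp (h : C -> C) f x : @continuous T CU f x -> ccont h (f x) ->
  @continuous T CU (fun y => h (f y)) x.
Proof. apply (@continuous_comp T CU CU). Qed.

Lemma cont_Re f x : @continuous T CU f x -> continuous (fun y => Re (f y)) x.
Proof.
intros H. rewrite ccont_eps in H. apply filterlim_locally. intros eps.
apply (filter_imp _ _ (fun y Hy => Rle_lt_trans _ _ _ (re_le_Cmod _) Hy) (H eps)).
Qed.

Lemma cont_Im f x : @continuous T CU f x -> continuous (fun y => Im (f y)) x.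
Proof.
intros H. rewrite ccont_eps in H. apply filterlim_locally. intros eps.
apply (filter_imp _ _ (fun y Hy => Rle_lt_trans _ _ _ (im_le_Cmod _) Hy) (H eps)).
Qed.

Lemma cont_pair (u v : T -> R) x : continuous u x -> continuous v x ->
  @continuous T CU (fun y => (u y, v y)) x.
Proof.
intros Hu Hv. apply ccont_eps. intros eps.
assert (He : 0 < eps / 4) by (destruct eps; simpl; lra).
assert (Hu' := proj1 (filterlim_locally _ _) Hu (mkposreal _ He)).
assert (Hv' := proj1 (filterlim_locally _ _) Hv (mkposreal _ He)).
generalize (filter_and _ _ Hu' Hv'). apply filter_imp. intros y [H1 H2].
apply Rle_lt_trans with (2 * (eps / 4)); [|destruct eps; simpl; lra].
apply Cmod_le_components; left; assumption.
Qed.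

Lemma cont_conj f x : @continuous T CU f x -> @continuous T CU (fun y => Cconj (f y)) x.
Proof.
intros H. apply (cont_pair (fun y => Re (f y)) (fun y => - Im (f y))).
- now apply cont_Re.
- apply (@continuous_opp T R_AbsRing R_NormedModule). now apply cont_Im.
Qed.
End Continuity.

Lemma cont_RtoC (t : R) : rcont RtoC t.
Proof. apply cont_pair; [apply continuous_id|apply continuous_const]. Qed.

(** Integration over [[0, 1]] only; other intervals and contours are reparametrized. *)
Definition CInt (f : R -> C) : C :=
  (RInt (fun t => Re (f t)) 0 1, RInt (fun t => Im (f t)) 0 1).

Lemma Re_ex_RInt (f : R -> C) (a b : R) :
  (forall t, rcont f t) -> ex_RInt (fun t => Re (f t)) a b.
Proof. intros H. apply (@ex_RInt_continuous R_CompleteNormedModule). intros z _.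
apply cont_Re, H. Qed.

Lemma Im_ex_RInt (f : R -> C) (a b : R) :
  (forall t, rcont f t) -> ex_RInt (fun t => Im (f t)) a b.
Proof. intros H. apply (@ex_RInt_continuous R_CompleteNormedModule). intros z _.
apply cont_Im, H. Qed.

Lemma CInt_ext (f g : R -> C) : (forall t, 0 <= t <= 1 -> f t = g t) -> CInt f = CInt g.
Proof.
intros H. unfold CInt. f_equal; apply RInt_ext; intros x Hx;
rewrite Rmin_left, Rmax_right in Hx by lra; rewrite H; trivial; lra.
Qed.

Lemma CInt_plus (f g : R -> C) : (forall t, rcont f t) -> (forall t, rcont g t) ->
  CInt (fun t => f t + g t)%C = (CInt f + CInt g)%C.
Proof.
intros Hf Hg. apply injective_projections; simpl.
- exact (RInt_plus _ _ _ _ (Re_ex_RInt f 0 1 Hf) (Re_ex_RInt g 0 1 Hg)).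
- exact (RInt_plus _ _ _ _ (Im_ex_RInt f 0 1 Hf) (Im_ex_RInt g 0 1 Hg)).
Qed.

Lemma CInt_scal (c : C) (f : R -> C) : (forall t, rcont f t) ->
  CInt (fun t => c * f t)%C = (c * CInt f)%C.
Proof.
intros Hf. assert (H1 := Re_ex_RInt f 0 1 Hf). assert (H2 := Im_ex_RInt f 0 1 Hf).
destruct c as [a b].
assert (S : forall k (g : R -> R), ex_RInt g 0 1 -> RInt (fun t => k * g t) 0 1 = k * RInt g 0 1).
{ intros k g Hg. exact (RInt_scal g 0 1 k Hg). }
assert (E : forall k (g : R -> R), ex_RInt g 0 1 -> ex_RInt (fun t => k * g t) 0 1).
{ intros k g Hg. exact (ex_RInt_scal g 0 1 k Hg). }
apply injective_projections; simpl.
- rewrite <- S, <- (S b) by assumption.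
  exact (RInt_minus _ _ 0 1 (E a _ H1) (E b _ H2)).
- rewrite <- S, <- (S b) by assumption.
  exact (RInt_plus _ _ 0 1 (E a _ H2) (E b _ H1)).
Qed.

Lemma CInt_minus (f g : R -> C) : (forall t, rcont f t) -> (forall t, rcont g t) ->
  CInt (fun t => f t - g t)%C = (CInt f - CInt g)%C.
Proof.
intros Hf Hg.
transitivity (CInt (fun t => f t + (-1) * g t)%C); [apply CInt_ext; intros; ring|].
rewrite CInt_plus, CInt_scal; trivial; [ring|].
intros t. apply cont_mult; [apply cont_const|apply Hg].
Qed.

Lemma CInt_const (c : C) : CInt (fun _ => c) = c.
Proof.
unfold CInt. apply injective_projections; simpl;
rewrite RInt_const; unfold scal; simpl; unfold mult; simpl; unfold Re, Im; ring.
Qed.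

Lemma CInt_conj (f : R -> C) : (forall t, rcont f t) ->
  CInt (fun t => Cconj (f t)) = Cconj (CInt f).
Proof.
intros Hf. apply injective_projections; simpl; [reflexivity|].
exact (RInt_opp _ 0 1 (Im_ex_RInt f 0 1 Hf)).
Qed.

(** Real and imaginary parts are estimated separately, which costs a factor 2. It propagates to the
    Cauchy estimates, where constants are immaterial. *)
Lemma CInt_bound (f : R -> C) (M : R) : (forall t, rcont f t) ->
  (forall t, 0 <= t <= 1 -> Cmod (f t) <= M) -> Cmod (CInt f) <= 2 * M.
Proof.
intros Hf HM. apply Cmod_le_components; simpl.
- replace M with ((1 - 0) * M) by ring. apply abs_RInt_le_const; [lra|now apply Re_ex_RInt|].
  intros t Ht. eapply Rle_trans; [apply re_le_Cmod|]. now apply HM.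
- replace M with ((1 - 0) * M) by ring. apply abs_RInt_le_const; [lra|now apply Im_ex_RInt|].
  intros t Ht. eapply Rle_trans; [apply im_le_Cmod|]. now apply HM.
Qed.

(** Derivative of a path, taken componentwise so that the real fundamental theorem of calculus
    applies; [pderiv_eps] is the form suited to the chain rule. *)
Definition pderiv (g : R -> C) (t : R) (v : C) : Prop :=
  is_derive (fun s => Re (g s)) t (Re v) /\ is_derive (fun s => Im (g s)) t (Im v).

Lemma CInt_FTC (g g' : R -> C) :
  (forall t, pderiv g t (g' t)) -> (forall t, rcont g' t) -> CInt g' = (g 1 - g 0)%C.
Proof.
intros Hg Hc. apply injective_projections; simpl; apply is_RInt_unique.
- apply (is_RInt_derive (fun t => Re (g t))); intros x _; [apply Hg|apply cont_Re, Hc].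
- apply (is_RInt_derive (fun t => Im (g t))); intros x _; [apply Hg|apply cont_Im, Hc].
Qed.

Lemma is_derive_eps (f : R -> R) (x l : R) :
  is_derive f x l <-> forall eps : posreal, exists d : posreal, forall y,
    Rabs (y - x) < d -> Rabs (f y - f x - (y - x) * l) <= eps * Rabs (y - x).
Proof.
split.
- intros [_ H] eps. exact (H x (fun P HP => HP) eps).
- intros H. split; [apply is_linear_scal_l|].
  intros y Hy eps.
  rewrite <- (@is_filter_lim_locally_unique R_AbsRing R_NormedModule x y Hy). exact (H eps).
Qed.

Lemma pderiv_eps (g : R -> C) (t : R) (v : C) :
  pderiv g t v <-> forall eps : posreal, exists d : posreal, forall s,
    Rabs (s - t) < d -> Cmod (g s - g t - (s - t)%R * v)%C <= eps * Rabs (s - t).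
Proof.
unfold pderiv. rewrite !is_derive_eps. split.
- intros [H1 H2] eps.
  assert (He : 0 < eps / 2) by (destruct eps; simpl; lra).
  destruct (H1 (mkposreal _ He)) as [d1 D1]. destruct (H2 (mkposreal _ He)) as [d2 D2].
  assert (Hd : 0 < Rmin d1 d2) by (apply Rmin_glb_lt; apply cond_pos).
  exists (mkposreal _ Hd). simpl. intros s Hs.
  assert (A1 := Rmin_l d1 d2). assert (A2 := Rmin_r d1 d2).
  specialize (D1 s (Rlt_le_trans _ _ _ Hs A1)). specialize (D2 s (Rlt_le_trans _ _ _ Hs A2)).
  simpl in D1, D2.
  replace (eps * Rabs (s - t)) with (2 * (eps / 2 * Rabs (s - t))) by field.
  apply Cmod_le_components.
  + replace (Re _) with (Re (g s) - Re (g t) - (s - t) * Re v); [exact D1|].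
    unfold Re, Cminus, Cplus, Copp, Cmult, RtoC. simpl. ring.
  + replace (Im _) with (Im (g s) - Im (g t) - (s - t) * Im v); [exact D2|].
    unfold Im, Cminus, Cplus, Copp, Cmult, RtoC. simpl. ring.
- intros H. split; intros eps; destruct (H eps) as [d D]; exists d; intros s Hs;
  (eapply Rle_trans; [|apply (D s Hs)]).
  + eapply Rle_trans; [|apply re_le_Cmod]. right. f_equal.
    unfold Re, Cminus, Cplus, Copp, Cmult, RtoC. simpl. ring.
  + eapply Rle_trans; [|apply im_le_Cmod]. right. f_equal.
    unfold Im, Cminus, Cplus, Copp, Cmult, RtoC. simpl. ring.
Qed.

Lemma pderiv_cont (g : R -> C) (t : R) (v : C) : pderiv g t v -> rcont g t.
Proof.
intros [H1 H2].
apply (@continuous_ext R_UniformSpace CU (fun s => (Re (g s), Im (g s)))).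
{ intros s. now destruct (g s). }
apply cont_pair; apply (@ex_derive_continuous R_AbsRing R_NormedModule); eexists; eassumption.
Qed.

Lemma pderiv_comp (f : C -> C) (g : R -> C) (t : R) (l v : C) :
  cderiv f (g t) l -> pderiv g t v -> pderiv (fun s => f (g s)) t (v * l)%C.
Proof.
intros Hf Hg. assert (Hc := pderiv_cont _ _ _ Hg).
rewrite cderiv_eps in Hf. rewrite pderiv_eps in Hg |- *.
intros eps.
set (K := Cmod v + 1). assert (HK : 0 < K) by (unfold K; assert (A := Cmod_ge_0 v); lra).
assert (He : 0 < eps / (2 * K)).
{ apply Rdiv_lt_0_compat; [apply cond_pos|lra]. }
destruct (Hf (mkposreal _ He)) as [d1 D1].
set (m := Cmod l + 1). assert (Hm : 0 < m) by (unfold m; assert (A := Cmod_ge_0 l); lra).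
(* The bound 1 yields |g s - g t| <= K |s - t|; the bound eps/(2m) keeps the remainder of [g],
   multiplied by [l], within half of the allowed error. *)
assert (He2 : 0 < Rmin 1 (eps / (2 * m))).
{ apply Rmin_glb_lt; [lra|]. apply Rdiv_lt_0_compat; [apply cond_pos|lra]. }
destruct (Hg (mkposreal _ He2)) as [d2 D2].
destruct (proj1 (ccont_eps _ _) Hc d1) as [d3 D3].
assert (Hd : 0 < Rmin d2 d3) by (apply Rmin_glb_lt; apply cond_pos).
exists (mkposreal _ Hd). simpl. intros s Hs.
assert (A1 := Rmin_l d2 d3). assert (A2 := Rmin_r d2 d3).
specialize (D2 s (Rlt_le_trans _ _ _ Hs A1)). specialize (D3 s (Rlt_le_trans _ _ _ Hs A2)).
specialize (D1 (g s) D3). simpl in D1, D2.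
assert (B1 := Rmin_l 1 (eps / (2 * m))). assert (B2 := Rmin_r 1 (eps / (2 * m))).
set (h := Rabs (s - t)) in *. assert (Hh : 0 <= h) by apply Rabs_pos.
assert (G1 : Cmod (g s - g t)%C <= K * h).
{ replace (g s - g t)%C with ((g s - g t - (s - t)%R * v) + (s - t)%R * v)%C by ring.
  eapply Rle_trans; [apply Cmod_triangle|]. rewrite Cmod_mult, Cmod_R. fold h.
  unfold K. nra. }
replace (f (g s) - f (g t) - (s - t)%R * (v * l))%C with
  ((f (g s) - f (g t) - (g s - g t) * l) + (g s - g t - (s - t)%R * v) * l)%C by ring.
eapply Rle_trans; [apply Cmod_triangle|]. rewrite Cmod_mult.
assert (G2 : eps / (2 * K) * Cmod (g s - g t)%C <= eps / 2 * h).
{ eapply Rle_trans; [apply Rmult_le_compat_l; [lra|exact G1]|]. right. field. lra. }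
assert (G3 : Cmod (g s - g t - (s - t)%R * v)%C * Cmod l <= eps / (2 * m) * h * m).
{ apply Rmult_le_compat; try apply Cmod_ge_0; [|unfold m; lra].
  eapply Rle_trans; [exact D2|]. apply Rmult_le_compat_r; [exact Hh|exact B2]. }
replace (eps / (2 * m) * h * m) with (eps / 2 * h) in G3 by (field; lra).
lra.
Qed.

Lemma pderiv_line (a b : C) (t : R) : pderiv (fun s => a + s * b)%C t b.
Proof. split; simpl; auto_derive; trivial; unfold Re, Im; ring. Qed.

Lemma rcont_line (a b : C) (t : R) : rcont (fun s => a + s * b)%C t.
Proof. exact (pderiv_cont _ _ _ (pderiv_line a b t)). Qed.

(** * Parametric integrals *)

(** Heine's theorem for the two real components on the square that contains the disc. *)
Lemma unif_cont (f : C -> C) (r : R) (eps : posreal) : (forall z, ccont f z) ->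
  exists d : posreal, forall z w, Cmod z <= r -> Cmod w <= r ->
    Cmod (w - z)%C < d -> Cmod (f w - f z)%C < eps.
Proof.
intros Hf.
assert (He : 0 < eps / 4) by (destruct eps; simpl; lra).
assert (Hu : forall p : C -> R, (forall z w, Rabs (p w - p z) <= Cmod (w - z)%C) ->
  exists d : posreal, forall x y u v, -r <= x <= r -> -r <= y <= r -> -r <= u <= r ->
    -r <= v <= r -> Rabs (u - x) < d -> Rabs (v - y) < d ->
    Rabs (p (f (u, v)) - p (f (x, y))) < eps / 4).
{ intros p Hp.
  apply (uniform_continuity_2d (fun x y => p (f (x, y))) (-r) r (-r) r) with (eps := mkposreal _ He).
  intros x y _ _ e. destruct (proj1 (ccont_eps_C f (x, y)) (Hf _) e) as [d Hd].
  assert (Hd2 : 0 < d / 4) by (destruct d; simpl; lra).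
  exists (mkposreal _ Hd2). simpl. intros u v Hu Hv.
  eapply Rle_lt_trans; [apply Hp|]. apply Hd.
  apply Rle_lt_trans with (2 * (d / 4)); [|destruct d; simpl; lra].
  apply Cmod_le_components; left; assumption. }
destruct (Hu Re) as [d1 D1].
{ intros z w. exact (re_le_Cmod (w - z)%C). }
destruct (Hu Im) as [d2 D2].
{ intros z w. exact (im_le_Cmod (w - z)%C). }
assert (Hd : 0 < Rmin d1 d2) by (apply Rmin_glb_lt; apply cond_pos).
exists (mkposreal _ Hd). simpl. intros [x y] [u v] Hz Hw Hzw.
assert (A1 := Rmin_l d1 d2). assert (A2 := Rmin_r d1 d2).
assert (Bd : forall c : C, Cmod c <= r -> -r <= fst c <= r /\ -r <= snd c <= r).
{ intros c Hc. assert (E1 := re_le_Cmod c). assert (E2 := im_le_Cmod c). unfold Re, Im in *.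
  split; apply Rabs_le_between; lra. }
destruct (Bd _ Hz) as [B1 B2]. destruct (Bd _ Hw) as [B3 B4]. simpl in B1, B2, B3, B4.
assert (C1 := Rle_lt_trans _ _ _ (re_le_Cmod _) Hzw).
assert (C2 := Rle_lt_trans _ _ _ (im_le_Cmod _) Hzw).
simpl in C1, C2.
apply Rle_lt_trans with (2 * (eps / 4)); [|destruct eps; simpl; lra].
apply Cmod_le_components; left; [apply D1|apply D2]; trivial; unfold Rminus in *; lra.
Qed.

Lemma FTC_line (F f : C -> C) (a h : C) :
  (forall z, cderiv F z (f z)) -> (forall z, ccont f z) ->
  (h * CInt (fun t : R => f (a + t * h)%C))%C = (F (a + h)%C - F a)%C.
Proof.
intros HF Hf.
assert (Hc : forall t, rcont (fun t : R => f (a + t * h)%C) t).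
{ intros t. apply (cont_comp f (fun t : R => a + t * h)%C); [apply rcont_line|apply Hf]. }
rewrite <- CInt_scal by exact Hc.
rewrite (CInt_FTC (fun t => F (a + t * h)%C)).
- f_equal; f_equal; try (f_equal); ring.
- intros t. apply (pderiv_comp F (fun t : R => a + t * h)%C); [apply HF|apply pderiv_line].
- intros t. apply cont_mult; [apply cont_const|apply Hc].
Qed.

Lemma cderiv_zero_const (F : C -> C) : (forall z, cderiv F z 0) -> forall z, F z = F 0.
Proof.
intros H z.
assert (E := FTC_line F (fun _ => 0) 0 z H (fun w => cont_const (T := CU) 0 w)).
cbv beta in E. rewrite CInt_const, Cplus_0_l, Cmult_0_r in E.
replace (F z) with (F z - F 0 + F 0)%C by ring. rewrite <- E. ring.
Qed.

(** The remainder equals k times the integral of f'(b + tk) - f'(b) over [0, 1], which uniform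
    continuity of f' makes small independently of b. *)
Lemma uniform_taylor (f f' : C -> C) (r : R) (eps : posreal) :
  (forall z, cderiv f z (f' z)) -> (forall z, ccont f' z) ->
  exists d : posreal, forall b k, Cmod b <= r -> Cmod k < d ->
    Cmod (f (b + k)%C - f b - k * f' b)%C <= eps * Cmod k.
Proof.
intros Hf Hc.
assert (He : 0 < eps / 2) by (destruct eps; simpl; lra).
(* The extra 1 in the radius leaves room for b + tk with |k| < 1. *)
destruct (unif_cont f' (r + 1) (mkposreal _ He) Hc) as [d Hd]. simpl in Hd.
assert (Hd1 : 0 < Rmin d 1) by (apply Rmin_glb_lt; [apply cond_pos|lra]).
exists (mkposreal _ Hd1). simpl. intros b k Hb Hk.
assert (A1 := Rmin_l d 1). assert (A2 := Rmin_r d 1).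
rewrite <- (FTC_line f f' b k Hf Hc).
assert (Hl : forall t, rcont (fun t : R => f' (b + t * k)%C) t).
{ intros t. apply (cont_comp f' (fun t : R => b + t * k)%C); [apply rcont_line|apply Hc]. }
replace (k * CInt (fun t => f' (b + t * k)) - k * f' b)%C
  with (k * CInt (fun t => f' (b + t * k) - f' b))%C.
2:{ rewrite CInt_minus, CInt_const; [ring|exact Hl|intros; apply cont_const]. }
rewrite Cmod_mult, Rmult_comm. apply Rmult_le_compat_r; [apply Cmod_ge_0|].
replace (pos eps) with (2 * (eps / 2)) by field.
apply CInt_bound.
- intros t. apply cont_minus; [apply Hl|apply cont_const].
- intros t Ht. left.
  assert (Htk : Cmod (t * k)%C <= Cmod k).
  { rewrite Cmod_mult, Cmod_R, Rabs_right by lra. assert (G := Cmod_ge_0 k). nra. }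
  apply Hd.
  + lra.
  + eapply Rle_trans; [apply Cmod_triangle|]. lra.
  + replace (b + t * k - b)%C with (t * k)%C by ring. lra.
Qed.

Lemma rcont_bounded (p : R -> C) : (forall t, rcont p t) ->
  exists B, 0 <= B /\ forall t, 0 <= t <= 1 -> Cmod (p t) <= B.
Proof.
intros Hp.
assert (H : forall q : R -> R, (forall t, continuous q t) ->
  exists B, forall t, 0 <= t <= 1 -> Rabs (q t) <= B).
{ intros q Hq. destruct (continuity_ab_maj (fun t => Rabs (q t)) 0 1) as [m [Hm _]]; [lra| |].
  - intros c _. apply continuity_pt_filterlim.
    apply (continuous_comp q Rabs); [apply Hq|apply continuous_Rabs].
  - exists (Rabs (q m)). exact Hm. }
destruct (H (fun t => Re (p t))) as [B1 H1]; [intros; now apply cont_Re|].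
destruct (H (fun t => Im (p t))) as [B2 H2]; [intros; now apply cont_Im|].
assert (E : forall t, 0 <= t <= 1 -> Cmod (p t) <= 2 * Rmax B1 B2).
{ intros t Ht. apply Cmod_le_components.
  - eapply Rle_trans; [apply H1; exact Ht|apply Rmax_l].
  - eapply Rle_trans; [apply H2; exact Ht|apply Rmax_r]. }
exists (2 * Rmax B1 B2). split; [|exact E].
eapply Rle_trans; [apply Cmod_ge_0|apply (E 0); lra].
Qed.

(** Differentiation under the integral sign. The affine argument p + wq covers all later uses:
    moving the center of a circle (q = 1), its radius (q = [circ]), and scaling a segment from 0 (q
    = t). *)
Lemma cderiv_CInt (f f' : C -> C) (p q phi : R -> C) (w : C) :
  (forall z, cderiv f z (f' z)) -> (forall z, ccont f' z) ->
  (forall t, rcont p t) -> (forall t, rcont q t) -> (forall t, rcont phi t) ->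
  cderiv (fun w => CInt (fun t => f (p t + w * q t) * phi t)%C) w
    (CInt (fun t => f' (p t + w * q t) * q t * phi t)%C).
Proof.
intros Hf Hf' Hp Hq Hphi.
assert (Hcf : forall z, ccont f z) by (intros z; exact (cderiv_ccont _ _ _ (Hf z))).
assert (Hin : forall v t, rcont (fun t => p t + v * q t)%C t).
{ intros v t. apply cont_plus; [apply Hp|]. apply cont_mult; [apply cont_const|apply Hq]. }
assert (Hi1 : forall v t, rcont (fun t => f (p t + v * q t) * phi t)%C t).
{ intros v t. apply cont_mult; [|apply Hphi].
  apply (cont_comp f (fun t => p t + v * q t)%C); [apply Hin|apply Hcf]. }
assert (Hi2 : forall t, rcont (fun t => f' (p t + w * q t) * q t * phi t)%C t).
{ intros t. apply cont_mult; [|apply Hphi]. apply cont_mult; [|apply Hq].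
  apply (cont_comp f' (fun t => p t + w * q t)%C); [apply Hin|apply Hf']. }
destruct (rcont_bounded _ (Hin w)) as [Bb [HBb Bb']].
destruct (rcont_bounded _ Hq) as [Bq [HBq Bq']].
destruct (rcont_bounded _ Hphi) as [Bp [HBp Bp']].
apply cderiv_eps. intros eps.
set (M := (Bq + 1) * (Bp + 1)). assert (HM : 0 < M) by (unfold M; nra).
assert (He : 0 < eps / (2 * M)) by (apply Rdiv_lt_0_compat; [apply cond_pos|lra]).
destruct (uniform_taylor f f' Bb (mkposreal _ He) Hf Hf') as [d Hd]. simpl in Hd.
assert (Hd1 : 0 < d / (Bq + 1)) by (apply Rdiv_lt_0_compat; [apply cond_pos|lra]).
exists (mkposreal _ Hd1). simpl. intros v Hv.
rewrite <- CInt_scal by exact Hi2.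
rewrite <- CInt_minus by (intros; apply Hi1).
rewrite <- CInt_minus.
2:{ intros t. apply cont_minus; apply Hi1. }
2:{ intros t. apply cont_mult; [apply cont_const|apply Hi2]. }
replace (eps * Cmod (v - w)%C) with (2 * (eps / 2 * Cmod (v - w)%C)) by field.
apply CInt_bound.
{ intros t. apply cont_minus; [apply cont_minus; apply Hi1|].
  apply cont_mult; [apply cont_const|apply Hi2]. }
intros t Ht. specialize (Bb' t Ht). specialize (Bq' t Ht). specialize (Bp' t Ht).
set (b := (p t + w * q t)%C) in *. set (k := ((v - w) * q t)%C).
replace (p t + v * q t)%C with (b + k)%C by (unfold b, k; ring).
replace (f (b + k) * phi t - f b * phi t - (v - w) * (f' b * q t * phi t))%C
  with ((f (b + k) - f b - k * f' b) * phi t)%C by (unfold k; ring).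
assert (Hk : Cmod k <= Cmod (v - w)%C * (Bq + 1)).
{ unfold k. rewrite Cmod_mult. apply Rmult_le_compat_l; [apply Cmod_ge_0|lra]. }
assert (Hk' : Cmod k < d).
{ eapply Rle_lt_trans; [exact Hk|]. apply Rmult_lt_reg_r with (/ (Bq + 1)).
  - apply Rinv_0_lt_compat; lra.
  - rewrite Rmult_assoc, Rinv_r, Rmult_1_r by lra. exact Hv. }
rewrite Cmod_mult. specialize (Hd b k Bb' Hk').
apply Rle_trans with (eps / (2 * M) * (Cmod (v - w)%C * (Bq + 1)) * (Bp + 1)).
- apply Rmult_le_compat; try apply Cmod_ge_0; [|lra].
  eapply Rle_trans; [exact Hd|]. apply Rmult_le_compat_l; lra.
- right. unfold M. field. lra.
Qed.

Lemma ccont_CInt (f : C -> C) (p phi : R -> C) (w : C) :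
  (forall z, ccont f z) -> (forall t, rcont p t) -> (forall t, rcont phi t) ->
  ccont (fun w => CInt (fun t => f (w + p t) * phi t)%C) w.
Proof.
intros Hf Hp Hphi.
assert (Hin : forall v t, rcont (fun t => v + p t)%C t).
{ intros v t. apply cont_plus; [apply cont_const|apply Hp]. }
assert (Hi1 : forall v t, rcont (fun t => f (v + p t) * phi t)%C t).
{ intros v t. apply cont_mult; [|apply Hphi].
  apply (cont_comp f (fun t => v + p t)%C); [apply Hin|apply Hf]. }
destruct (rcont_bounded _ (Hin w)) as [Bb [HBb Bb']].
destruct (rcont_bounded _ Hphi) as [Bp [HBp Bp']].
apply ccont_eps_C. intros eps.
assert (He : 0 < eps / (4 * (Bp + 1))) by (apply Rdiv_lt_0_compat; [apply cond_pos|lra]).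
destruct (unif_cont f (Bb + 1) (mkposreal _ He) Hf) as [d Hd]. simpl in Hd.
assert (Hd1 : 0 < Rmin d 1) by (apply Rmin_glb_lt; [apply cond_pos|lra]).
exists (mkposreal _ Hd1). simpl. intros v Hv.
assert (A1 := Rmin_l d 1). assert (A2 := Rmin_r d 1).
rewrite <- CInt_minus by (intros; apply Hi1).
apply Rle_lt_trans with (2 * (eps / 4)); [|destruct eps; simpl; lra].
apply CInt_bound.
{ intros t. apply cont_minus; apply Hi1. }
intros t Ht. specialize (Bb' t Ht). specialize (Bp' t Ht).
replace (f (v + p t) * phi t - f (w + p t) * phi t)%C
  with ((f (v + p t) - f (w + p t)) * phi t)%C by ring.
rewrite Cmod_mult.
assert (Hvw : (v + p t - (w + p t) = v - w)%C) by ring.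
apply Rle_trans with (eps / (4 * (Bp + 1)) * (Bp + 1)); [|right; field; lra].
apply Rmult_le_compat; try apply Cmod_ge_0; [|lra].
left. apply Hd; [lra| |rewrite Hvw; lra].
replace (v + p t)%C with ((w + p t) + (v - w))%C by ring.
eapply Rle_trans; [apply Cmod_triangle|]. lra.
Qed.

(** * Goursat's theorem *)

Lemma RInt_reverse (g : R -> R) : (forall t, continuous g t) ->
  RInt (fun t => g (1 - t)) 0 1 = RInt g 0 1.
Proof.
intros Hg.
assert (Hex : forall a b, ex_RInt g a b).
{ intros a b. apply (@ex_RInt_continuous R_CompleteNormedModule). intros z _. apply Hg. }
assert (E := RInt_comp_lin g (-1) 1 0 1 (Hex _ _)).
replace (-1 * 0 + 1) with 1 in E by ring. replace (-1 * 1 + 1) with 0 in E by ring.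
rewrite <- (opp_RInt_swap g 0 1 (Hex _ _)) in E.
assert (Hr : ex_RInt (fun t => g (1 - t)) 0 1).
{ apply (@ex_RInt_continuous R_CompleteNormedModule). intros z _.
  apply (continuous_comp (fun t => 1 - t) g); [|apply Hg].
  apply (@ex_derive_continuous R_AbsRing R_NormedModule). auto_derive. trivial. }
assert (E2 : RInt (fun y => scal (-1) (g (-1 * y + 1))) 0 1 = RInt (fun t => scal (-1) (g (1 - t))) 0 1).
{ apply RInt_ext. intros x _. f_equal. f_equal. ring. }
assert (E3 := RInt_scal _ 0 1 (-1) Hr).
assert (E4 : scal (-1) (RInt (fun t => g (1 - t)) 0 1) = opp (RInt g 0 1)).
{ exact (eq_trans (eq_sym E3) (eq_trans (eq_sym E2) E)). }
unfold scal, opp in E4. simpl in E4. unfold mult in E4. simpl in E4. lra.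
Qed.

Lemma RInt_halves (g : R -> R) : (forall t, continuous g t) ->
  RInt g 0 1 = / 2 * RInt (fun t => g (/ 2 * t + 0)) 0 1 + / 2 * RInt (fun t => g (/ 2 * t + / 2)) 0 1.
Proof.
intros Hg.
assert (Hex : forall a b, ex_RInt g a b).
{ intros a b. apply (@ex_RInt_continuous R_CompleteNormedModule). intros z _. apply Hg. }
assert (Hr : forall c, ex_RInt (fun t => g (/ 2 * t + c)) 0 1).
{ intros c. apply (@ex_RInt_continuous R_CompleteNormedModule). intros z _.
  apply (continuous_comp (fun t => / 2 * t + c) g); [|apply Hg].
  apply (@ex_derive_continuous R_AbsRing R_NormedModule). auto_derive. trivial. }
assert (E1 := RInt_comp_lin g (/ 2) 0 0 1 (Hex _ _)).
assert (E2 := RInt_comp_lin g (/ 2) (/ 2) 0 1 (Hex _ _)).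
assert (F1 := RInt_scal _ 0 1 (/ 2) (Hr 0)). assert (F2 := RInt_scal _ 0 1 (/ 2) (Hr (/ 2))).
assert (E1' := eq_trans (eq_sym F1) E1). assert (E2' := eq_trans (eq_sym F2) E2). clear E1 E2.
rename E1' into E1. rename E2' into E2.
replace (/ 2 * 0 + 0) with 0 in E1 by ring. replace (/ 2 * 1 + 0) with (/ 2) in E1 by ring.
replace (/ 2 * 0 + / 2) with (/ 2) in E2 by ring. replace (/ 2 * 1 + / 2) with 1 in E2 by field.
rewrite <- (RInt_Chasles g 0 (/ 2) 1 (Hex _ _) (Hex _ _)), <- E1, <- E2. reflexivity.
Qed.

Definition seg (f : C -> C) (a b : C) : C := ((b - a) * CInt (fun t => f (a + t * (b - a))))%C.

Section Segments.
Variable f : C -> C.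
Hypothesis Hf : forall z, ccont f z.

Lemma rcont_seg (a b : C) (t : R) : rcont (fun t : R => f (a + t * b)%C) t.
Proof. apply (cont_comp f (fun t : R => a + t * b)%C); [apply rcont_line|apply Hf]. Qed.

Lemma seg_rev (a b : C) : seg f b a = (- seg f a b)%C.
Proof.
unfold seg.
replace (CInt (fun t => f (b + t * (a - b))%C)) with (CInt (fun t => f (a + t * (b - a))%C)); [ring|].
apply injective_projections; simpl.
- rewrite <- (RInt_reverse (fun t => Re (f (a + t * (b - a))%C))).
  + apply RInt_ext. intros x _. f_equal. f_equal. rewrite RtoC_minus. ring.
  + intros t. apply cont_Re, rcont_seg.
- rewrite <- (RInt_reverse (fun t => Im (f (a + t * (b - a))%C))).
  + apply RInt_ext. intros x _. f_equal. f_equal. rewrite RtoC_minus. ring.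
  + intros t. apply cont_Im, rcont_seg.
Qed.

Lemma seg_split (a b : C) : seg f a b = (seg f a ((a + b) / 2) + seg f ((a + b) / 2) b)%C.
Proof.
assert (H2 : RtoC 2 <> 0) by (intros H; apply RtoC_inj in H; lra).
unfold seg. set (m := ((a + b) / 2)%C).
assert (E1 : (m - a = (b - a) * RtoC (/ 2))%C) by (rewrite RtoC_inv by lra; unfold m; field; exact H2).
assert (E2 : (b - m = (b - a) * RtoC (/ 2))%C) by (rewrite RtoC_inv by lra; unfold m; field; exact H2).
rewrite E1, E2.
assert (E : CInt (fun t => f (a + t * (b - a))%C) =
  (RtoC (/ 2) * (CInt (fun t => f (a + t * ((b - a) * RtoC (/ 2)))) +
   CInt (fun t => f (m + t * ((b - a) * RtoC (/ 2))))))%C).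
{ assert (X : forall p : C -> R, (forall t, continuous (fun t : R => p (f (a + t * (b - a))%C)) t) ->
    RInt (fun t => p (f (a + t * (b - a))%C)) 0 1 =
    / 2 * RInt (fun t => p (f (a + t * ((b - a) * RtoC (/ 2)))%C)) 0 1 +
    / 2 * RInt (fun t => p (f (m + t * ((b - a) * RtoC (/ 2)))%C)) 0 1).
  { intros p Hp. rewrite (RInt_halves _ Hp). f_equal; f_equal; apply RInt_ext; intros x _;
    f_equal; f_equal; rewrite RtoC_plus, RtoC_mult, RtoC_inv by lra; unfold m; field; exact H2. }
  apply injective_projections; simpl.
  - rewrite (X Re); [unfold Re; ring|]. intros t. apply cont_Re, rcont_seg.
  - rewrite (X Im); [unfold Im; ring|]. intros t. apply cont_Im, rcont_seg. }
rewrite E. ring.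
Qed.

Lemma seg_bound (a b : C) (M : R) :
  (forall t : R, 0 <= t <= 1 -> Cmod (f (a + t * (b - a))%C) <= M) ->
  Cmod (seg f a b) <= 2 * M * Cmod (b - a)%C.
Proof.
intros HM. unfold seg. rewrite Cmod_mult, Rmult_comm. apply Rmult_le_compat_r; [apply Cmod_ge_0|].
apply CInt_bound; [intros t; apply rcont_seg|exact HM].
Qed.
End Segments.

Lemma seg_minus (f g : C -> C) (a b : C) : (forall z, ccont f z) -> (forall z, ccont g z) ->
  seg (fun z => f z - g z)%C a b = (seg f a b - seg g a b)%C.
Proof.
intros Hf Hg. unfold seg. rewrite CInt_minus; [ring| |]; intros t.
- exact (rcont_seg f Hf a (b - a)%C t).
- exact (rcont_seg g Hg a (b - a)%C t).
Qed.

Lemma seg_FTC (F f : C -> C) (a b : C) :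
  (forall z, cderiv F z (f z)) -> (forall z, ccont f z) -> seg f a b = (F b - F a)%C.
Proof.
intros HF Hf. unfold seg. rewrite (FTC_line F f a (b - a)%C HF Hf). f_equal. f_equal. ring.
Qed.

Definition tri (f : C -> C) (a b c : C) : C := (seg f a b + seg f b c + seg f c a)%C.

(** Subdivision at the midpoints: each inner edge is traversed once in either direction and
    cancels. *)
Lemma tri_split (f : C -> C) (a b c : C) : (forall z, ccont f z) ->
  tri f a b c =
  (tri f a ((a + b) / 2) ((c + a) / 2) + tri f ((a + b) / 2) b ((b + c) / 2) +
   tri f ((c + a) / 2) ((b + c) / 2) c + tri f ((b + c) / 2) ((c + a) / 2) ((a + b) / 2))%C.
Proof.
intros Hf. unfold tri.
rewrite (seg_split f Hf a b), (seg_split f Hf b c), (seg_split f Hf c a).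
rewrite (seg_rev f Hf ((b + c) / 2) ((a + b) / 2))%C.
rewrite (seg_rev f Hf ((c + a) / 2) ((b + c) / 2))%C.
rewrite (seg_rev f Hf ((a + b) / 2) ((c + a) / 2))%C. ring.
Qed.

Definition triangle : Type := (C * C * C)%type.
Definition small (T : triangle) (d : R) : Prop :=
  let '(a, b, c) := T in Cmod (a - b)%C <= d /\ Cmod (b - c)%C <= d /\ Cmod (c - a)%C <= d.
Definition triT (f : C -> C) (T : triangle) : C := let '(a, b, c) := T in tri f a b c.

Lemma Cmod_half (z : C) : Cmod (z / 2)%C = Cmod z / 2.
Proof.
rewrite Cmod_div by (intros H; apply RtoC_inj in H; lra).
rewrite Cmod_R, Rabs_right; lra.
Qed.

(** One of the four midpoint triangles carries at least a quarter of the integral. The size claim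
    holds for every [d], so that the choice of T' is independent of it; the shift of the first
    vertex feeds [Cauchy_limit]. *)
Lemma triangle_step (f : C -> C) (T : triangle) : (forall z, ccont f z) ->
  exists T' : triangle, Cmod (triT f T) <= 4 * Cmod (triT f T') /\
    forall d, small T d -> small T' (d / 2) /\ Cmod (fst (fst T') - fst (fst T))%C <= d.
Proof.
intros Hf. destruct T as [[a b] c]. simpl.
assert (H2 : RtoC 2 <> 0) by (intros H; apply RtoC_inj in H; lra).
assert (E := tri_split f a b c Hf).
set (t1 := tri f a ((a + b) / 2) ((c + a) / 2)) in E.
set (t2 := tri f ((a + b) / 2) b ((b + c) / 2)) in E.
set (t3 := tri f ((c + a) / 2) ((b + c) / 2) c) in E.
set (t4 := tri f ((b + c) / 2) ((c + a) / 2) ((a + b) / 2)) in E.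
assert (Hsum : Cmod (tri f a b c) <= Cmod t1 + Cmod t2 + Cmod t3 + Cmod t4).
{ rewrite E. eapply Rle_trans; [apply Cmod_triangle|]. apply Rplus_le_compat_r.
  eapply Rle_trans; [apply Cmod_triangle|]. apply Rplus_le_compat_r. apply Cmod_triangle. }
assert (K : forall x y d, Cmod y <= d -> (x = y / 2 \/ x = - (y / 2))%C -> Cmod x <= d / 2).
{ intros x y d Hy [-> | ->]; rewrite ?Cmod_opp, Cmod_half; lra. }
assert (Kd : forall x d, 0 <= Cmod x -> Cmod x <= d / 2 -> Cmod x <= d) by (intros; lra).
destruct (Rle_or_lt (Cmod (tri f a b c)) (4 * Cmod t1)) as [C1|C1];
[|destruct (Rle_or_lt (Cmod (tri f a b c)) (4 * Cmod t2)) as [C2|C2];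
[|destruct (Rle_or_lt (Cmod (tri f a b c)) (4 * Cmod t3)) as [C3|C3];
[|destruct (Rle_or_lt (Cmod (tri f a b c)) (4 * Cmod t4)) as [C4|C4]]]].
- exists (a, (a + b) / 2, (c + a) / 2)%C. split; [exact C1|]. intros d [S1 [S2 S3]]. simpl.
  repeat split.
  + apply (K _ _ d S1). left. field; exact H2.
  + apply (K _ _ d S2). left. field; exact H2.
  + apply (K _ _ d S3). left. field; exact H2.
  + replace (a - a)%C with (RtoC 0) by ring. rewrite Cmod_0.
    eapply Rle_trans; [apply Cmod_ge_0|exact S1].
- exists ((a + b) / 2, b, (b + c) / 2)%C. split; [exact C2|]. intros d [S1 [S2 S3]]. simpl.
  repeat split.
  + apply (K _ _ d S1). left. field; exact H2.
  + apply (K _ _ d S2). left. field; exact H2.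
  + apply (K _ _ d S3). left. field; exact H2.
  + apply Kd; [apply Cmod_ge_0|]. apply (K _ _ d S1). right. field; exact H2.
- exists ((c + a) / 2, (b + c) / 2, c)%C. split; [exact C3|]. intros d [S1 [S2 S3]]. simpl.
  repeat split.
  + apply (K _ _ d S1). left. field; exact H2.
  + apply (K _ _ d S2). left. field; exact H2.
  + apply (K _ _ d S3). left. field; exact H2.
  + apply Kd; [apply Cmod_ge_0|]. apply (K _ _ d S3). left. field; exact H2.
- exists ((b + c) / 2, (c + a) / 2, (a + b) / 2)%C. split; [exact C4|]. intros d [S1 [S2 S3]].
  simpl. repeat split.
  + apply (K _ _ d S1). right. field; exact H2.
  + apply (K _ _ d S2). right. field; exact H2.
  + apply (K _ _ d S3). right. field; exact H2.
  + replace ((b + c) / 2 - a)%C with ((c - a) / 2 + - ((a - b) / 2))%C by (field; exact H2).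
    eapply Rle_trans; [apply Cmod_triangle|]. rewrite Cmod_opp, !Cmod_half. lra.
- exfalso. lra.
Qed.

(** The increments from index n on sum to at most 2K/2^n, a geometric series; treating Re and Im
    separately doubles this. *)
Lemma Cauchy_limit (u : nat -> C) (K : R) :
  (forall n, Cmod (u (S n) - u n)%C <= K * (/ 2) ^ n) ->
  exists p, forall n, Cmod (u n - p)%C <= 4 * K * (/ 2) ^ n.
Proof.
intros H.
assert (HK : 0 <= K).
{ assert (H0 := H 0%nat). simpl in H0. assert (G := Cmod_ge_0 (u 1%nat - u 0%nat)%C). lra. }
assert (Hp : forall n, 0 < (/ 2) ^ n) by (intros n; apply pow_lt; lra).
assert (H' : forall n k, Cmod (u (n + k)%nat - u n)%C <= 2 * K * (/ 2) ^ n - 2 * K * (/ 2) ^ (n + k)).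
{ intros n. induction k as [|k IH].
  - rewrite Nat.add_0_r. replace (u n - u n)%C with (RtoC 0) by ring. rewrite Cmod_0. lra.
  - rewrite Nat.add_succ_r. eapply Rle_trans; [apply (Cmod_minus_triangle _ (u (n + k)%nat))|].
    assert (G := H (n + k)%nat). simpl pow. lra. }
assert (Hlim : forall q : C -> R, (forall a b, Rabs (q a - q b) <= Cmod (a - b)%C) ->
  exists l, forall n, Rabs (q (u n) - l) <= 2 * K * (/ 2) ^ n).
{ intros q Hq.
  assert (Hc : ex_lim_seq_cauchy (fun n => q (u n))).
  { intros eps.
    destruct (pow_lt_1_zero (/ 2)) with (y := eps / (4 * (K + 1))) as [N HN].
    - rewrite Rabs_right; lra.
    - apply Rdiv_lt_0_compat; [apply cond_pos|lra].
    - assert (HN' : 2 * K * (/ 2) ^ N < eps / 2).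
      { assert (G := HN N (le_n N)). rewrite Rabs_right in G by (left; apply Hp).
        apply Rle_lt_trans with (2 * (K + 1) * (/ 2) ^ N).
        - assert (G' := Hp N). nra.
        - replace (eps / 2) with (2 * (K + 1) * (eps / (4 * (K + 1)))) by (field; lra).
          apply Rmult_lt_compat_l; lra. }
      exists N. intros n m Hn Hm.
      assert (B : forall j, (N <= j)%nat -> Rabs (q (u j) - q (u N)) < eps / 2).
      { intros j Hj. eapply Rle_lt_trans; [apply Hq|].
        replace j with (N + (j - N))%nat by lia.
        eapply Rle_lt_trans; [apply H'|]. assert (G := Hp (N + (j - N))%nat). nra. }
      assert (B1 := B n Hn). assert (B2 := B m Hm).
      apply Rabs_def2 in B1. apply Rabs_def2 in B2. apply Rabs_def1; lra. }
  apply ex_lim_seq_cauchy_corr in Hc. destruct Hc as [l Hl]. exists l. intros n.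
  assert (L : is_lim_seq (fun k => Rabs (q (u n) - q (u (k + n)%nat))) (Rabs (q (u n) - l))).
  { apply (is_lim_seq_abs _ (q (u n) - l)).
    apply (is_lim_seq_minus' (fun _ => q (u n)) _ (q (u n)) l); [apply is_lim_seq_const|].
    now apply (is_lim_seq_incr_n (fun k => q (u k)) n). }
  apply (is_lim_seq_le _ (fun _ => 2 * K * (/ 2) ^ n) _ (2 * K * (/ 2) ^ n)) in L.
  - exact L.
  - intros k. rewrite Rabs_minus_sym. eapply Rle_trans; [apply Hq|].
    rewrite Nat.add_comm. eapply Rle_trans; [apply H'|].
    assert (G := Hp (n + k)%nat). nra.
  - apply is_lim_seq_const. }
destruct (Hlim Re) as [x Hx]. { intros a b. exact (re_le_Cmod (a - b)%C). }
destruct (Hlim Im) as [y Hy]. { intros a b. exact (im_le_Cmod (a - b)%C). }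
exists (x, y). intros n. replace (4 * K * (/ 2) ^ n) with (2 * (2 * K * (/ 2) ^ n)) by ring.
apply Cmod_le_components; [apply Hx|apply Hy].
Qed.

Theorem Goursat (f : C -> C) (a b c : C) : entire f -> tri f a b c = 0.
Proof.
intros Hf.
assert (Hc : forall z, ccont f z) by (intros z; now apply entire_ccont).
set (next := fun T => proj1_sig (constructive_indefinite_description _ (triangle_step f T Hc))).
assert (Hnext : forall T, Cmod (triT f T) <= 4 * Cmod (triT f (next T)) /\
    forall d, small T d -> small (next T) (d / 2) /\ Cmod (fst (fst (next T)) - fst (fst T))%C <= d).
{ intros T. unfold next.
  apply (proj2_sig (constructive_indefinite_description _ (triangle_step f T Hc))). }
set (Tn := fix Tn n := match n with O => (a, b, c) | S n => next (Tn n) end).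
set (L := Cmod (a - b)%C + Cmod (b - c)%C + Cmod (c - a)%C).
assert (G1 := Cmod_ge_0 (a - b)%C). assert (G2 := Cmod_ge_0 (b - c)%C).
assert (G3 := Cmod_ge_0 (c - a)%C).
assert (HL : 0 <= L) by (unfold L; lra).
assert (Hs : forall n, small (Tn n) (L * (/ 2) ^ n)).
{ induction n as [|n IH].
  - simpl. unfold L. repeat split; lra.
  - destruct (Hnext (Tn n)) as [_ H]. apply H in IH. destruct IH as [IH _].
    change (small (next (Tn n)) (L * (/ 2) ^ S n)).
    replace (L * (/ 2) ^ S n) with (L * (/ 2) ^ n / 2) by (simpl; field). exact IH. }
assert (Ht : forall n, Cmod (tri f a b c) <= 4 ^ n * Cmod (triT f (Tn n))).
{ induction n as [|n IH].
  - simpl. lra.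
  - eapply Rle_trans; [exact IH|]. destruct (Hnext (Tn n)) as [H _].
    simpl pow. assert (0 < 4 ^ n) by (apply pow_lt; lra).
    change (Tn (S n)) with (next (Tn n)). nra. }
destruct (Cauchy_limit (fun n => fst (fst (Tn n))) L) as [p Hp].
{ intros n. apply (Hnext (Tn n)), Hs. }
destruct (proj1 (entire_cderiv f) Hf p) as [l Hl]. rewrite cderiv_eps in Hl.
assert (Hall : forall eps, 0 < eps -> Cmod (tri f a b c) <= 30 * L * L * eps).
(* With s = 2^-N the vertices lie within 5Ls of [p]: 4Ls from [Cauchy_limit], and Ls for a side.
   Each side contributes at most 2 (eps 5Ls)(Ls), the three together 30 eps L^2 s^2, and s^2 cancels
   the factor 4^N. *)
{ intros eps Heps. destruct (Hl (mkposreal _ Heps)) as [d Hd]. simpl in Hd.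
  destruct (pow_lt_1_zero (/ 2)) with (y := d / (5 * (L + 1))) as [N HN].
  { rewrite Rabs_right; lra. }
  { apply Rdiv_lt_0_compat; [apply cond_pos|lra]. }
  specialize (HN N (le_n N)).
  assert (Hpw : 0 < (/ 2) ^ N) by (apply pow_lt; lra).
  rewrite Rabs_right in HN by lra.
  eapply Rle_trans; [apply (Ht N)|].
  specialize (Hs N). specialize (Hp N). set (s := (/ 2) ^ N) in *.
  assert (E4 : 4 ^ N * (s * s) = 1).
  { unfold s. rewrite <- !Rpow_mult_distr. replace (4 * (/ 2 * / 2)) with 1 by field. apply pow1. }
  assert (Hsd : 5 * L * s < d).
  { apply Rle_lt_trans with (5 * (L + 1) * s); [nra|].
    replace (pos d) with (5 * (L + 1) * (d / (5 * (L + 1)))) by (field; lra).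
    apply Rmult_lt_compat_l; lra. }
  destruct (Tn N) as [[a' b'] c']. simpl in Hs, Hp. destruct Hs as [S1 [S2 S3]].
  assert (Hb' : Cmod (b' - p)%C <= 5 * L * s).
  { assert (G := Cmod_minus_triangle b' a' p). rewrite (Cmod_minus_sym b' a') in G. lra. }
  assert (Hc' : Cmod (c' - p)%C <= 5 * L * s).
  { assert (G := Cmod_minus_triangle c' a' p). lra. }
  (* The affine part of [f] at [p] has the primitive [G] below, so its integral over the triangle
     vanishes and only the remainder counts. *)
  set (g := fun z : C => (f p + (z - p) * l)%C).
  assert (Hg : forall z, ccont g z).
  { intros z. apply cont_plus; [apply cont_const|]. apply cont_mult; [|apply cont_const].
    apply cont_minus; [apply continuous_id|apply cont_const]. }
  set (G := fun z : C => (f p * z + (z - p) * (z - p) * (l / 2))%C).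
  assert (Hg0 : forall u v, seg g u v = (G v - G u)%C).
  { intros u v. apply (seg_FTC G g); [|exact Hg]. intros z. unfold g, G.
    eapply cderiv_eq.
    - apply cderiv_plus; [apply cderiv_scal, cderiv_id|].
      apply cderiv_mult; [|apply cderiv_const].
      apply cderiv_mult; (apply cderiv_minus; [apply cderiv_id|apply cderiv_const]).
    - cbv beta; field; intros H; apply RtoC_inj in H; lra. }
  assert (Htri : tri f a' b' c' = tri (fun z => f z - g z)%C a' b' c').
  { unfold tri. rewrite !seg_minus by assumption. rewrite !Hg0. ring. }
  simpl. rewrite Htri.
  assert (Hsb : forall u v, Cmod (u - p)%C <= 5 * L * s -> Cmod (v - p)%C <= 5 * L * s ->
    Cmod (u - v)%C <= L * s -> Cmod (seg (fun z => f z - g z)%C u v) <= 10 * eps * L * L * (s * s)).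
  { intros u v Hu Hv Huv.
    assert (Hpt : 0 <= 5 * L * s) by (eapply Rle_trans; [apply Cmod_ge_0|exact Hu]).
    eapply Rle_trans.
    - apply (seg_bound (fun z => f z - g z)%C) with (M := eps * (5 * L * s)).
      + intros z. exact (cont_minus (T := CU) f g z (Hc z) (Hg z)).
      + intros t Ht'. unfold g.
        assert (Hw : Cmod (u + t * (v - u) - p)%C <= 5 * L * s).
        { replace (u + t * (v - u) - p)%C with (RtoC (1 - t) * (u - p) + t * (v - p))%C
            by (rewrite RtoC_minus; ring).
          eapply Rle_trans; [apply Cmod_triangle|].
          rewrite !Cmod_mult, !Cmod_R, !Rabs_right by lra. nra. }
        replace (f (u + t * (v - u)) - (f p + (u + t * (v - u) - p) * l))%C
          with (f (u + t * (v - u)) - f p - (u + t * (v - u) - p) * l)%C by ring.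
        eapply Rle_trans; [apply Hd; lra|]. apply Rmult_le_compat_l; lra.
    - rewrite (Cmod_minus_sym v u).
      replace (10 * eps * L * L * (s * s)) with (2 * (eps * (5 * L * s)) * (L * s)) by ring.
      apply Rmult_le_compat_l; [|exact Huv]. nra. }
  assert (T1 := Cmod_triangle (seg (fun z => f z - g z) a' b' + seg (fun z => f z - g z) b' c')%C (seg (fun z => f z - g z) c' a')%C).
  assert (T2 := Cmod_triangle (seg (fun z => f z - g z) a' b')%C (seg (fun z => f z - g z) b' c')%C).
  assert (Ha' : Cmod (a' - p)%C <= 5 * L * s) by nra.
  assert (B1 := Hsb a' b' Ha' Hb' S1). assert (B2 := Hsb b' c' Hb' Hc' S2).
  assert (B3 := Hsb c' a' Hc' Ha' S3).
  unfold tri.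
  apply Rle_trans with (4 ^ N * (3 * (10 * eps * L * L * (s * s)))).
  - apply Rmult_le_compat_l; [left; apply pow_lt; lra|]. lra.
  - right. transitivity (30 * eps * L * L * (4 ^ N * (s * s))); [ring|]. rewrite E4. ring. }
apply Cmod_eq_0. apply Rle_antisym; [|apply Cmod_ge_0].
apply Rnot_lt_le. intros Hpos. set (x := Cmod (tri f a b c)) in *.
assert (Heps : 0 < x / (60 * L * L + 60)) by (apply Rdiv_lt_0_compat; nra).
specialize (Hall _ Heps).
assert (E : (60 * L * L + 60) * (x / (60 * L * L + 60)) = x) by (field; nra).
nra.
Qed.

(** The primitive is the integral along the segment from 0. By Goursat on the triangle 0, z, w its
    increment is the integral over [z, w], where [f] is close to f(z). *)
Lemma entire_primitive (f : C -> C) : entire f -> exists F, forall z, cderiv F z (f z).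
Proof.
intros Hf. exists (fun z => seg f 0 z).
assert (Hc : forall z, ccont f z) by (intros z; now apply entire_ccont).
intros z. apply cderiv_eps. intros eps.
assert (He : 0 < eps / 2) by (destruct eps; simpl; lra).
destruct (proj1 (ccont_eps_C f z) (Hc z) (mkposreal _ He)) as [d Hd]. simpl in Hd.
exists d. intros w Hw.
assert (E : (seg f 0 w - seg f 0 z = seg f z w)%C).
{ assert (G := Goursat f 0 z w Hf). unfold tri in G.
  rewrite (seg_rev f Hc 0 w) in G.
  replace (seg f z w) with (seg f 0 z + seg f z w + - seg f 0 w + seg f 0 w - seg f 0 z)%C by ring.
  rewrite G. ring. }
rewrite E.
replace (seg f z w - (w - z) * f z)%C with (seg (fun y => f y - f z)%C z w).
2:{ rewrite (seg_minus f (fun _ => f z)); [|exact Hc|intros y; exact (cont_const (T := CU) _ y)].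
    unfold seg at 2. rewrite CInt_const. reflexivity. }
replace (pos eps) with (2 * (eps / 2)) by field.
apply (seg_bound (fun y => f y - f z)%C).
- intros y. exact (cont_minus (T := CU) f (fun _ => f z) y (Hc y) (cont_const _ y)).
- intros t Ht. left. apply Hd.
  replace (z + t * (w - z) - z)%C with (t * (w - z))%C by ring.
  rewrite Cmod_mult, Cmod_R, Rabs_right by lra.
  assert (G := Cmod_ge_0 (w - z)%C). nra.
Qed.

(** * Cauchy estimates *)

Lemma Cmult_integral (a b : C) : (a * b = 0)%C -> a = 0 \/ b = 0.
Proof.
intros H. apply (f_equal Cmod) in H. rewrite Cmod_mult, Cmod_0 in H.
destruct (Rmult_integral _ _ H) as [E|E]; apply Cmod_eq_0 in E; tauto.
Qed.

Definition circ (t : R) : C := (cos (2 * PI * t), sin (2 * PI * t)).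
Definition two_pi_i : C := (0, 2 * PI).

Lemma two_pi_i_neq0 : two_pi_i <> 0.
Proof. intros H. apply (f_equal snd) in H. simpl in H. assert (G := PI_RGT_0). lra. Qed.

Lemma circ_1 : circ 1 = circ 0.
Proof. unfold circ. rewrite Rmult_0_r, Rmult_1_r, cos_2PI, sin_2PI, cos_0, sin_0. reflexivity. Qed.

Lemma circ_conj (t : R) : (circ t * Cconj (circ t) = 1)%C.
Proof.
unfold circ. apply injective_projections; simpl; [|ring].
assert (G := sin2_cos2 (2 * PI * t)). unfold Rsqr in G. lra.
Qed.

Lemma Cmod_circ (t : R) : Cmod (circ t) = 1.
Proof.
unfold Cmod, circ. simpl. transitivity (sqrt 1); [f_equal|apply sqrt_1].
assert (G := sin2_cos2 (2 * PI * t)). unfold Rsqr in G. lra.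
Qed.

Lemma pderiv_circ (t : R) : pderiv circ t (two_pi_i * circ t)%C.
Proof. split; simpl; auto_derive; trivial; unfold Re, Im; simpl; ring. Qed.

Lemma pderiv_circ_conj (t : R) :
  pderiv (fun t => Cconj (circ t)) t (- (two_pi_i * Cconj (circ t)))%C.
Proof. split; simpl; auto_derive; trivial; unfold Re, Im; simpl; ring. Qed.

Lemma rcont_circ (t : R) : rcont circ t.
Proof. exact (pderiv_cont _ _ _ (pderiv_circ t)). Qed.

Lemma rcont_circ_conj (t : R) : rcont (fun t => Cconj (circ t)) t.
Proof. exact (pderiv_cont _ _ _ (pderiv_circ_conj t)). Qed.

Lemma pderiv_mult (f g : R -> C) (t : R) (a b : C) : pderiv f t a -> pderiv g t b ->
  pderiv (fun s => f s * g s)%C t (a * g t + f t * b)%C.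
Proof.
intros [F1 F2] [G1 G2].
assert (M : forall u v t a b, is_derive u t a -> is_derive v t b ->
  is_derive (fun s : R => u s * v s) t (a * v t + u t * b)).
{ intros u v x c d Hu Hv. apply (@is_derive_mult R_AbsRing u v x c d Hu Hv Rmult_comm). }
split; unfold Re, Im.
- replace (fst (a * g t + f t * b)%C) with ((Re a * Re (g t) + Re (f t) * Re b) - (Im a * Im (g t) + Im (f t) * Im b))
    by (unfold Re, Im, Cplus, Cmult; simpl; ring).
  apply (@is_derive_minus R_AbsRing R_NormedModule (fun s => Re (f s) * Re (g s)) (fun s => Im (f s) * Im (g s)));
  now apply M.
- replace (snd (a * g t + f t * b)%C) with ((Re a * Im (g t) + Re (f t) * Im b) + (Im a * Re (g t) + Im (f t) * Re b))
    by (unfold Re, Im, Cplus, Cmult; simpl; ring).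
  apply (@is_derive_plus R_AbsRing R_NormedModule (fun s => Re (f s) * Im (g s)) (fun s => Im (f s) * Re (g s)));
  now apply M.
Qed.

Lemma pderiv_circle (a w : C) (t : R) : pderiv (fun t => a + w * circ t)%C t (w * (two_pi_i * circ t))%C.
Proof.
replace (w * (two_pi_i * circ t))%C with (two_pi_i * circ t * w)%C by ring.
apply (pderiv_comp (fun z => a + w * z)%C circ t w); [|apply pderiv_circ].
eapply cderiv_eq; [apply cderiv_plus; [apply cderiv_const|apply cderiv_scal, cderiv_id]|ring].
Qed.

Lemma rcont_circle (f : C -> C) (a w : C) (t : R) : (forall z, ccont f z) ->
  rcont (fun t => f (a + w * circ t)%C) t.
Proof.
intros Hf. apply (cont_comp f (fun t => a + w * circ t)%C); [|apply Hf].
exact (pderiv_cont _ _ _ (pderiv_circle a w t)).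
Qed.

Lemma circle_integral (F f : C -> C) (a w : C) :
  (forall z, cderiv F z (f z)) -> (forall z, ccont f z) ->
  (w * CInt (fun t => f (a + w * circ t) * circ t) = 0)%C.
Proof.
intros HF Hf.
assert (Hc : forall t, rcont (fun t => f (a + w * circ t) * circ t)%C t).
{ intros t. apply cont_mult; [now apply rcont_circle|apply rcont_circ]. }
assert (E : CInt (fun t => (w * two_pi_i) * (f (a + w * circ t) * circ t))%C = 0).
{ rewrite (CInt_FTC (fun t => F (a + w * circ t)%C)).
  - rewrite circ_1. ring.
  - intros t.
    replace (w * two_pi_i * (f (a + w * circ t) * circ t))%C
      with (w * (two_pi_i * circ t) * f (a + w * circ t))%C by ring.
    apply (pderiv_comp F (fun t => a + w * circ t)%C); [apply HF|apply pderiv_circle].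
  - intros t. apply cont_mult; [apply cont_const|apply Hc]. }
rewrite CInt_scal in E by exact Hc.
assert (N := two_pi_i_neq0).
replace (w * CInt (fun t => f (a + w * circ t) * circ t))%C
  with (w * two_pi_i * CInt (fun t => f (a + w * circ t) * circ t) / two_pi_i)%C by (field; exact N).
rewrite E. field. exact N.
Qed.

Lemma CInt_circ : CInt circ = 0.
Proof.
assert (E := circle_integral (fun z => z) (fun _ => 1) 0 1 cderiv_id (fun z => cont_const (T := CU) 1 z)).
cbv beta in E. rewrite Cmult_1_l in E. rewrite <- E. apply CInt_ext. intros; ring.
Qed.

Lemma CInt_circ_conj : CInt (fun t => Cconj (circ t)) = 0.
Proof. rewrite CInt_conj by apply rcont_circ. rewrite CInt_circ.
apply injective_projections; simpl; ring. Qed.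

(** As a function of the complex radius w, the circle mean has derivative zero, because [f] has a
    primitive; hence it equals its value at w = 0. *)
Lemma mean_value_C1 (F f : C -> C) (a w : C) :
  (forall z, cderiv F z (f z)) -> (forall z, ccont f z) ->
  CInt (fun t => F (a + w * circ t)%C) = F a.
Proof.
intros HF Hf.
assert (HcF : forall z, ccont F z) by (intros z; exact (cderiv_ccont _ _ _ (HF z))).
set (M := fun w : C => CInt (fun t => F (a + w * circ t) * 1)%C).
assert (HM : forall w, cderiv M w 0).
{ intros v. eapply cderiv_eq.
  - apply (cderiv_CInt F f (fun _ => a) circ (fun _ => 1) v HF Hf);
    intros t; try apply cont_const. apply rcont_circ.
  - assert (E := circle_integral F f a v HF Hf).
    rewrite (CInt_ext _ (fun t => f (a + v * circ t) * circ t)%C) by (intros; ring).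
    (* [circle_integral] carries the factor v, which cannot be cancelled at v = 0; there the
       integrand is a multiple of [circ]. *)
    destruct (classic (v = 0)) as [-> | Hv].
    + rewrite (CInt_ext _ (fun t => f a * circ t)%C).
      * rewrite CInt_scal, CInt_circ by apply rcont_circ. ring.
      * intros t _. f_equal. f_equal. ring.
    + destruct (Cmult_integral _ _ E) as [H|H]; [now elim Hv|exact H]. }
assert (E := cderiv_zero_const M HM w). unfold M in E.
rewrite (CInt_ext _ (fun t => F (a + w * circ t) * 1)%C) by (intros; ring).
rewrite E. rewrite (CInt_ext _ (fun _ => F a)); [apply CInt_const|].
intros t _. rewrite Cmult_1_r. f_equal. ring.
Qed.

(** [G' = f] is only known to be continuous, so [mean_value_C1] does not apply to [f];
    the mean value property of [G] is differentiated with respect to the center instead. *)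
Lemma mean_value (f : C -> C) (a w : C) : entire f -> CInt (fun t => f (a + w * circ t)%C) = f a.
Proof.
intros Hf. destruct (entire_primitive f Hf) as [G HG].
assert (Hc : forall z, ccont f z) by (intros z; now apply entire_ccont).
apply (cderiv_unique G a); [|apply HG].
assert (H := cderiv_CInt G f (fun t => w * circ t)%C (fun _ => 1) (fun _ => 1) a HG Hc).
assert (Hr : forall t, rcont (fun t => w * circ t)%C t).
{ intros t. apply cont_mult; [apply cont_const|apply rcont_circ]. }
specialize (H Hr (fun t => cont_const 1 t) (fun t => cont_const 1 t)).
eapply cderiv_eq.
- eapply cderiv_ext; [|exact H]. intros b. simpl.
  rewrite <- (mean_value_C1 G f b w HG Hc). apply CInt_ext. intros t _.
  rewrite Cmult_1_r. f_equal. ring.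
- apply CInt_ext. intros t _. rewrite !Cmult_1_r. f_equal. ring.
Qed.

(** Cauchy's formula for the derivative on the unit circle, where the conjugate of [circ t] is its
    inverse. It makes the derivative a total function that can itself be differentiated under the
    integral. *)
Definition Cderive (f : C -> C) (a : C) : C := CInt (fun t => f (a + circ t) * Cconj (circ t))%C.

(** Integrating the t-derivative of F(a + w circ) / circ around the circle gives 0, so the mean of F
    / circ is w times the mean of [f], to which [mean_value] applies. *)
Lemma cauchy_formula_C1 (F f : C -> C) (a w : C) :
  entire f -> (forall z, cderiv F z (f z)) ->
  (CInt (fun t => F (a + w * circ t) * Cconj (circ t)) = w * f a)%C.
Proof.
intros Hf HF.
assert (HcF : forall z, ccont F z) by (intros z; exact (cderiv_ccont _ _ _ (HF z))).
assert (Hcf : forall z, ccont f z) by (intros z; now apply entire_ccont).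
rewrite <- (mean_value f a w Hf).
assert (C1 : forall t, rcont (fun t => F (a + w * circ t) * Cconj (circ t))%C t).
{ intros t. apply cont_mult; [now apply rcont_circle|apply rcont_circ_conj]. }
assert (C2 : forall t, rcont (fun t => f (a + w * circ t))%C t) by (intros t; now apply rcont_circle).
assert (C3 : forall t, rcont (fun t => w * f (a + w * circ t))%C t).
{ intros t. apply cont_mult; [apply cont_const|apply C2]. }
assert (C4 : forall t, rcont (fun t => w * f (a + w * circ t) - F (a + w * circ t) * Cconj (circ t))%C t).
{ intros t. apply cont_minus; [apply C3|apply C1]. }
assert (E : CInt (fun t => two_pi_i * (w * f (a + w * circ t) - F (a + w * circ t) * Cconj (circ t)))%C = 0).
{ rewrite (CInt_FTC (fun t => F (a + w * circ t) * Cconj (circ t))%C).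
  - rewrite circ_1. ring.
  - intros t.
    replace (two_pi_i * (w * f (a + w * circ t) - F (a + w * circ t) * Cconj (circ t)))%C
      with ((w * (two_pi_i * circ t)) * f (a + w * circ t) * Cconj (circ t) +
        F (a + w * circ t) * - (two_pi_i * Cconj (circ t)))%C.
    + apply (pderiv_mult (fun t => F (a + w * circ t)%C)); [|apply pderiv_circ_conj].
      apply (pderiv_comp F (fun t => a + w * circ t)%C); [apply HF|apply pderiv_circle].
    + transitivity (two_pi_i * (w * f (a + w * circ t) * (circ t * Cconj (circ t)) - F (a + w * circ t) * Cconj (circ t)))%C;
      [ring|]. rewrite circ_conj. ring.
  - intros t. apply cont_mult; [apply cont_const|apply C4]. }
rewrite CInt_scal in E by exact C4.
destruct (Cmult_integral _ _ E) as [H|H]; [now elim two_pi_i_neq0|].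
rewrite CInt_minus in H by assumption. rewrite CInt_scal in H by exact C2.
match goal with |- ?x = ?y => replace x with (y - (y - x))%C by ring; rewrite H; ring end.
Qed.

(** [cauchy_formula_C1] writes f(b) as an integral of its primitive [G]; differentiating this in the
    center b requires of [f] only continuity. *)
Lemma Cderive_cderiv_of_C1 (G f : C -> C) (a : C) : entire f -> (forall z, cderiv G z (f z)) -> cderiv f a (Cderive f a).
Proof.
intros Hf HG.
assert (Hc : forall z, ccont f z) by (intros z; now apply entire_ccont).
eapply cderiv_eq.
- eapply cderiv_ext.
  2:{ apply (cderiv_CInt G f circ (fun _ => 1) (fun t => Cconj (circ t)) a HG Hc); intros t;
      [apply rcont_circ|apply cont_const|apply rcont_circ_conj]. }
  intros b. simpl. rewrite <- (Cmult_1_l (f b)), <- (cauchy_formula_C1 G f b 1 Hf HG).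
  apply CInt_ext. intros t _. do 2 f_equal. ring.
- unfold Cderive. apply CInt_ext. intros t _. rewrite Cmult_1_r. do 2 f_equal. ring.
Qed.

Lemma Cderive_cderiv (f : C -> C) (a : C) : entire f -> cderiv f a (Cderive f a).
Proof. intros Hf. destruct (entire_primitive f Hf) as [G HG].
exact (Cderive_cderiv_of_C1 G f a Hf HG). Qed.

Lemma Cderive_eq (f : C -> C) (a l : C) : entire f -> cderiv f a l -> Cderive f a = l.
Proof. intros Hf Hl. exact (cderiv_unique f a _ _ (Cderive_cderiv f a Hf) Hl). Qed.

(** [ccont_CInt] makes the derivative continuous, so its integral formula may be differentiated once
    more. *)
Lemma Cderive_entire (f : C -> C) : entire f -> entire (Cderive f).
Proof.
intros Hf.
assert (Hc : forall z, ccont f z) by (intros z; now apply entire_ccont).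
assert (HD : forall z, ccont (Cderive f) z).
{ intros z. apply (ccont_CInt f circ (fun t => Cconj (circ t)));
  [exact Hc|apply rcont_circ|apply rcont_circ_conj]. }
apply entire_cderiv. intros z. eexists.
eapply cderiv_ext.
2:{ apply (cderiv_CInt f (Cderive f) circ (fun _ => 1) (fun t => Cconj (circ t)) z (fun z => Cderive_cderiv f z Hf) HD);
    intros t; [apply rcont_circ|apply cont_const|apply rcont_circ_conj]. }
intros b. unfold Cderive. apply CInt_ext. intros t _. do 2 f_equal. ring.
Qed.

Lemma cauchy_formula (f : C -> C) (a w : C) : entire f ->
  (CInt (fun t => f (a + w * circ t) * Cconj (circ t)) = w * Cderive f a)%C.
Proof. intros Hf.
apply cauchy_formula_C1; [now apply Cderive_entire|intros z; now apply Cderive_cderiv]. Qed.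

Lemma cauchy_estimate (f : C -> C) (a : C) (r M : R) : entire f -> 0 <= r ->
  (forall z, Cmod (z - a)%C <= r -> Cmod (f z) <= M) -> r * Cmod (Cderive f a) <= 2 * M.
Proof.
intros Hf Hr HM.
replace r with (Cmod r) at 1 by (rewrite Cmod_R; apply Rabs_right; lra).
rewrite <- Cmod_mult, <- cauchy_formula by exact Hf.
apply CInt_bound.
- intros t.
  apply cont_mult; [apply rcont_circle; intros; now apply entire_ccont|apply rcont_circ_conj].
- intros t _. rewrite Cmod_mult, Cmod_conj, Cmod_circ, Rmult_1_r. apply HM.
  replace (a + r * circ t - a)%C with (r * circ t)%C by ring.
  rewrite Cmod_mult, Cmod_circ, Cmod_R, Rabs_right; lra.
Qed.

Lemma Cderive_zero_const (f : C -> C) : entire f -> (forall z, Cderive f z = 0) -> forall z, f z = f 0.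
Proof.
intros Hf H. apply cderiv_zero_const. intros z. rewrite <- (H z). now apply Cderive_cderiv.
Qed.

Theorem Liouville (f : C -> C) (M : R) : entire f -> (forall z, Cmod (f z) <= M) ->
  forall z, f z = f 0.
Proof.
intros Hf HM. apply Cderive_zero_const; [exact Hf|]. intros z. apply Cmod_eq_0.
apply Rle_antisym; [|apply Cmod_ge_0]. apply Rnot_lt_le. intros Hpos.
assert (HM0 : 0 <= M) by (eapply Rle_trans; [apply Cmod_ge_0|apply (HM 0)]).
set (x := Cmod (Cderive f z)) in *.
(* With this radius the Cauchy estimate reads 2M + 1 <= 2M. *)
assert (Hr : 0 <= (2 * M + 1) / x) by (left; apply Rdiv_lt_0_compat; lra).
assert (E := cauchy_estimate f z _ M Hf Hr (fun w _ => HM w)). fold x in E.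
replace ((2 * M + 1) / x * x) with (2 * M + 1) in E by (field; lra). lra.
Qed.

(** The quotient (f(z) - f(0))/z is written as the integral of f'(tz) over [0, 1], which is visibly
    entire at 0 and inherits bounds on f'. *)
Lemma divide_z (f : C -> C) : entire f ->
  exists h, entire h /\ (forall z, f z = f 0 + z * h z)%C /\
    forall z M, (forall w, Cmod w <= Cmod z -> Cmod (Cderive f w) <= M) -> Cmod (h z) <= 2 * M.
Proof.
intros Hf.
assert (HD : forall z, ccont (Cderive f) z) by (intros z; apply entire_ccont, Cderive_entire, Hf).
assert (Hl : forall z t, rcont (fun t : R => Cderive f (0 + t * z)%C) t).
{ intros z t.
  apply (cont_comp (Cderive f) (fun t : R => 0 + t * z)%C); [apply rcont_line|apply HD]. }
exists (fun z => CInt (fun t => Cderive f (0 + t * z)%C)). repeat split.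
- apply entire_cderiv. intros z. eexists. eapply cderiv_ext.
  2:{ apply (cderiv_CInt (Cderive f) (Cderive (Cderive f)) (fun _ => 0) RtoC (fun _ => 1) z).
      - intros w. apply Cderive_cderiv, Cderive_entire, Hf.
      - intros w. apply entire_ccont, Cderive_entire, Cderive_entire, Hf.
      - intros t; apply cont_const.
      - intros t; apply cont_RtoC.
      - intros t; apply cont_const. }
  intros w. apply CInt_ext. intros t _. rewrite Cmult_1_r. f_equal. ring.
- intros z. rewrite (FTC_line f (Cderive f) 0 z (fun z => Cderive_cderiv f z Hf) HD).
  rewrite Cplus_0_l. ring.
- intros z M HM. apply CInt_bound; [apply Hl|]. intros t Ht. apply HM.
  rewrite Cplus_0_l, Cmod_mult, Cmod_R, Rabs_right by lra. assert (G := Cmod_ge_0 z). nra.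
Qed.

(** An entire function of polynomial growth is a polynomial; only the consequence that it
    stays away from [0] at infinity is proved. *)
Lemma poly_growth_lower_bound (k : nat) (f : C -> C) (K : R) : entire f ->
  (forall z, Cmod (f z) <= K * (1 + Cmod z) ^ k) -> (exists z, f z <> 0) ->
  exists c r, 0 < c /\ forall z, r <= Cmod z -> c <= Cmod (f z).
Proof.
revert f K. induction k as [|k IH]; intros f K Hf HK [z0 Hz0].
- assert (E := Liouville f K Hf). exists (Cmod (f z0)), 0. split; [now apply Cmod_gt_0|].
  intros z _. rewrite (E) at 1; [|intros; rewrite <- (Rmult_1_r K); apply HK].
  rewrite <- (E) with (z := z); [lra|]. intros; rewrite <- (Rmult_1_r K); apply HK.
- destruct (divide_z f Hf) as [h [Hh [Eh Bh]]].
  assert (HK0 : 0 <= K).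
  { assert (G := HK 0). rewrite Cmod_0, Rplus_0_r, pow1, Rmult_1_r in G.
    eapply Rle_trans; [apply Cmod_ge_0|exact G]. }
  destruct (classic (exists z, h z <> 0)) as [Hn|Hn].
  + destruct (IH h (2 * (2 * K * 2 ^ S k)) Hh) as [c [r [Hc Hr]]]; [|exact Hn|].
    * intros z. replace (2 * (2 * K * 2 ^ S k) * (1 + Cmod z) ^ k)
        with (2 * (2 * K * 2 ^ S k * (1 + Cmod z) ^ k)) by ring.
      apply Bh. intros w Hw.
      assert (Gw := Cmod_ge_0 w).
      (* On this disc 1 + |u| <= 2(1 + |w|). Dividing the estimate by the radius 1 + |w| lowers the
         exponent from [S k] to [k]. *)
      assert (E := cauchy_estimate f w (1 + Cmod w) (K * (2 * (1 + Cmod w)) ^ S k) Hf).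
      assert (E' : (1 + Cmod w) * Cmod (Cderive f w) <= 2 * (K * (2 * (1 + Cmod w)) ^ S k)).
      { apply E; [lra|]. intros u Hu. eapply Rle_trans; [apply HK|].
        apply Rmult_le_compat_l; [exact HK0|]. apply pow_incr.
        assert (Gu := Cmod_triangle (u - w)%C w). replace (u - w + w)%C with u in Gu by ring.
        assert (G := Cmod_ge_0 u). lra. }
      rewrite Rpow_mult_distr in E'.
      apply Rmult_le_reg_l with (1 + Cmod w); [lra|]. eapply Rle_trans; [exact E'|].
      change ((1 + Cmod w) ^ S k) with ((1 + Cmod w) * (1 + Cmod w) ^ k).
      assert (P1 : (1 + Cmod w) ^ k <= (1 + Cmod z) ^ k) by (apply pow_incr; lra).
      replace (2 * (K * (2 ^ S k * ((1 + Cmod w) * (1 + Cmod w) ^ k))))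
        with ((1 + Cmod w) * (2 * K * 2 ^ S k * (1 + Cmod w) ^ k)) by ring.
      apply Rmult_le_compat_l; [lra|]. apply Rmult_le_compat_l; [|exact P1].
      assert (0 < 2 ^ S k) by (apply pow_lt; lra). nra.
    (* |f(z)| >= |z| |h(z)| - |f(0)| with |h(z)| >= c, so |z| >= 1 + |f(0)|/c leaves at least c. *)
    * exists c, (Rmax r (1 + Cmod (f 0) / c)). split; [exact Hc|]. intros z Hz.
      assert (A1 := Rmax_l r (1 + Cmod (f 0) / c)). assert (A2 := Rmax_r r (1 + Cmod (f 0) / c)).
      specialize (Hr z (Rle_trans _ _ _ A1 Hz)).
      assert (T := Cmod_triangle (f z) (- f 0)%C). rewrite Cmod_opp in T.
      rewrite (Eh z) in T at 1. replace (f 0 + z * h z + - f 0)%C with (z * h z)%C in T by ring.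
      rewrite Cmod_mult in T.
      assert (B : (1 + Cmod (f 0) / c) * c <= Cmod z * Cmod (h z)).
      { apply Rmult_le_compat; [|lra|lra|exact Hr].
        assert (0 <= Cmod (f 0) / c) by (apply Rdiv_le_0_compat; [apply Cmod_ge_0|exact Hc]). lra. }
      replace ((1 + Cmod (f 0) / c) * c) with (c + Cmod (f 0)) in B by (field; lra). lra.
  + assert (E : forall z, f z = f 0).
    { intros z. rewrite Eh. replace (h z) with (RtoC 0); [ring|].
      symmetry. apply NNPP. intros H. apply Hn. now exists z. }
    exists (Cmod (f z0)), 0. split; [now apply Cmod_gt_0|]. intros z _. rewrite (E z), (E z0). lra.
Qed.

(** * The exponential and logarithmic derivatives *)

Definition cexp (z : C) : C := (exp (Re z) * cos (Im z), exp (Re z) * sin (Im z)).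

Lemma cexp_plus (a b : C) : cexp (a + b)%C = (cexp a * cexp b)%C.
Proof.
unfold cexp, Re, Im. apply injective_projections; simpl; rewrite exp_plus.
- rewrite cos_plus. ring.
- rewrite sin_plus. ring.
Qed.

Lemma cexp_0 : cexp 0 = 1.
Proof. unfold cexp. simpl. rewrite exp_0, cos_0, sin_0.
apply injective_projections; simpl; ring. Qed.

Lemma cexp_opp (z : C) : (cexp z * cexp (- z) = 1)%C.
Proof. rewrite <- cexp_plus, <- cexp_0. f_equal. ring. Qed.

Lemma Cmod_cexp (z : C) : Cmod (cexp z) = exp (Re z).
Proof.
unfold Cmod, cexp. simpl.
transitivity (sqrt (Rsqr (exp (Re z)))).
- f_equal. assert (G := sin2_cos2 (Im z)). unfold Rsqr in *.
  transitivity (exp (Re z) * exp (Re z) * (sin (Im z) * sin (Im z) + cos (Im z) * cos (Im z))); [ring|].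
  rewrite G. ring.
- apply sqrt_Rsqr. left. apply exp_pos.
Qed.

Lemma cexp_neq0 (z : C) : cexp z <> 0.
Proof. apply Cmod_gt_0. rewrite Cmod_cexp. apply exp_pos. Qed.

(** Assembled from the real derivatives of exp, cos and sin at 0; the functional equation transports
    it to every point in [cderiv_cexp]. *)
Lemma cderiv_cexp_0 : cderiv cexp 0 1.
Proof.
apply cderiv_eps. intros eps.
(* Each component of the remainder will be at most 5em, below 6em, and [Cmod_le_components] doubles
   this: hence 12. The radius [d] is also capped by e, so that m < e absorbs the quadratic terms. *)
set (e := Rmin 1 (eps / 12)).
assert (He : 0 < e) by (unfold e; apply Rmin_glb_lt; [lra|destruct eps; simpl; lra]).
assert (He1 := Rmin_l 1 (eps / 12)). assert (He2 := Rmin_r 1 (eps / 12)). fold e in He1, He2.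
assert (X : forall f l, is_derive f 0 l -> exists d : posreal, forall h, Rabs h < d ->
  Rabs (f h - f 0 - h * l) <= e * Rabs h).
{ intros f l Hd. destruct (proj1 (is_derive_eps f 0 l) Hd (mkposreal _ He)) as [d D].
  exists d. intros h Hh. specialize (D h). rewrite Rminus_0_r in D. now apply D. }
assert (X1 : is_derive exp 0 1). { rewrite <- exp_0. apply is_derive_Reals, derivable_pt_lim_exp. }
assert (X2 : is_derive cos 0 0). { assert (G := derivable_pt_lim_cos 0).
rewrite sin_0, Ropp_0 in G. now apply is_derive_Reals. }
assert (X3 : is_derive sin 0 1). { rewrite <- cos_0. apply is_derive_Reals, derivable_pt_lim_sin. }
destruct (X exp 1 X1) as [d1 D1]. destruct (X cos 0 X2) as [d2 D2].
destruct (X sin 1 X3) as [d3 D3].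
set (d := Rmin (Rmin d1 d2) (Rmin d3 e)).
assert (Hd : 0 < d) by (apply Rmin_glb_lt; (apply Rmin_glb_lt; [apply cond_pos|]); [apply cond_pos|exact He]).
assert (A1 := Rmin_l (Rmin d1 d2) (Rmin d3 e)). assert (A2 := Rmin_r (Rmin d1 d2) (Rmin d3 e)).
assert (A3 := Rmin_l d1 d2). assert (A4 := Rmin_r d1 d2).
assert (A5 := Rmin_l d3 e). assert (A6 := Rmin_r d3 e). fold d in A1, A2.
exists (mkposreal _ Hd). simpl. intros w Hw.
replace (w - 0)%C with w in * by ring.
destruct w as [x y].
assert (Hx := re_le_Cmod (x, y)). assert (Hy := im_le_Cmod (x, y)). simpl in Hx, Hy.
set (m := Cmod (x, y)) in *.
assert (Hm : 0 <= m) by apply Cmod_ge_0.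
specialize (D1 x ltac:(lra)). specialize (D2 y ltac:(lra)). specialize (D3 y ltac:(lra)).
rewrite exp_0 in D1. rewrite cos_0 in D2. rewrite sin_0 in D3.
set (u := exp x - 1 - x * 1) in *. set (v := cos y - 1 - y * 0) in *.
set (s := sin y - 0 - y * 1) in *.
assert (Bu : Rabs u <= e * m) by nra. assert (Bv : Rabs v <= e * m) by nra.
assert (Bs : Rabs s <= e * m) by nra.
replace (eps * m) with (2 * (eps / 12 * m * 6)) by field.
assert (Hem : 0 <= e * m) by nra.
assert (Hem2 : e * m <= eps / 12 * m) by nra.
assert (Hmm : m * m <= e * m) by nra. assert (He3 : e * e <= e) by nra.
apply Rabs_le_between in Bu. apply Rabs_le_between in Bv. apply Rabs_le_between in Bs.
apply Rabs_le_between in Hx. apply Rabs_le_between in Hy.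
assert (He4 : e * m * e <= e * m) by nra.
assert (He5 : e * m * (e * m) <= e * m) by nra.
apply Cmod_le_components.
- replace (Re (cexp (x, y) - cexp 0 - (x, y) * 1)%C) with (u * (v + 1) + (1 + x) * v).
  2:{ unfold cexp, u, v, Re, Im, Cminus, Cplus, Copp, Cmult. simpl. rewrite exp_0, cos_0. ring. }
  assert (Rabs (u * (v + 1)) <= 2 * (e * m)).
  { rewrite Rabs_mult. assert (Rabs u <= e * m) by (apply Rabs_le_between; lra).
    assert (Rabs (v + 1) <= 2) by (apply Rabs_le_between; nra).
    assert (P1 := Rabs_pos u). assert (P2 := Rabs_pos (v + 1)). nra. }
  assert (Rabs ((1 + x) * v) <= 2 * (e * m)).
  { rewrite Rabs_mult. assert (Rabs v <= e * m) by (apply Rabs_le_between; lra).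
    assert (Rabs (1 + x) <= 2) by (apply Rabs_le_between; lra).
    assert (P1 := Rabs_pos v). assert (P2 := Rabs_pos (1 + x)). nra. }
  eapply Rle_trans; [apply Rabs_triang|]. lra.
- replace (Im (cexp (x, y) - cexp 0 - (x, y) * 1)%C) with ((u + x) * (s + y) + s).
  2:{ unfold cexp, u, s, Re, Im, Cminus, Cplus, Copp, Cmult. simpl. rewrite exp_0, sin_0. ring. }
  assert (Rabs ((u + x) * (s + y)) <= 4 * (e * m)).
  { rewrite Rabs_mult. assert (Q1 : Rabs (u + x) <= 2 * m) by (apply Rabs_le_between; nra).
    assert (Q2 : Rabs (s + y) <= 2 * m) by (apply Rabs_le_between; nra).
    assert (P1 := Rabs_pos (u + x)). assert (P2 := Rabs_pos (s + y)). nra. }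
  assert (Rabs s <= e * m) by (apply Rabs_le_between; lra).
  eapply Rle_trans; [apply Rabs_triang|]. lra.
Qed.

Lemma cderiv_cexp (z : C) : cderiv cexp z (cexp z).
Proof.
apply (cderiv_ext (fun w => cexp z * cexp (w - z))%C).
{ intros w. rewrite <- cexp_plus. f_equal. ring. }
eapply cderiv_eq.
- apply cderiv_scal. apply (cderiv_comp cexp (fun w => w - z)%C).
  + replace (z - z)%C with (RtoC 0) by ring. apply cderiv_cexp_0.
  + apply cderiv_minus; [apply cderiv_id|apply cderiv_const].
- ring.
Qed.

Lemma entire_comp (f g : C -> C) : entire f -> entire g -> entire (fun z => f (g z)).
Proof.
intros Hf Hg. apply (entire_intro _ (fun z => Cderive g z * Cderive f (g z))%C). intros z.
apply cderiv_comp; now apply Cderive_cderiv.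
Qed.

Lemma linear_ode (F : C -> C) (c : C) : (forall z, cderiv F z (c * F z)%C) ->
  forall z, F z = (F 0 * cexp (c * z))%C.
Proof.
intros H z.
set (E := fun z => cexp (- c * z)%C).
assert (HE : forall z, cderiv E z (- c * E z)%C).
{ intros w. unfold E. eapply cderiv_eq.
  - apply (cderiv_comp cexp (fun z => - c * z)%C); [apply cderiv_cexp|apply cderiv_scal, cderiv_id].
  - ring. }
assert (K := cderiv_zero_const (fun z => F z * E z)%C).
assert (K' : forall z, (F z * E z = F 0 * E 0)%C).
{ apply K. intros w. eapply cderiv_eq; [apply cderiv_mult; [apply H|apply HE]|]. ring. }
specialize (K' z). unfold E in K'.
replace (- c * z)%C with (- (c * z))%C in K' by ring.
replace (- c * 0)%C with (RtoC 0) in K' by ring. rewrite cexp_0, Cmult_1_r in K'.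
rewrite <- K'. transitivity (F z * (cexp (c * z) * cexp (- (c * z))))%C; [|ring].
rewrite cexp_opp. ring.
Qed.

(** [Fi] plays the role of 1/F, so F'/F is entire and has a primitive H; then F exp(-H) has
    derivative zero and is the constant [c]. *)
Lemma unit_log (F Fi : C -> C) : entire F -> entire Fi -> (forall z, F z * Fi z = 1)%C ->
  exists (H : C -> C) (c : C), (forall z, cderiv H z (Cderive F z * Fi z)%C) /\ c <> 0 /\ forall z, F z = (c * cexp (H z))%C.
Proof.
intros HF HFi Hu.
destruct (entire_primitive (fun z => Cderive F z * Fi z)%C) as [H HH].
{ apply entire_mult; [now apply Cderive_entire|exact HFi]. }
assert (K := cderiv_zero_const (fun z => F z * cexp (- H z))%C).
assert (K' : forall z, (F z * cexp (- H z) = F 0 * cexp (- H 0))%C).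
{ apply K. intros z. eapply cderiv_eq.
  - apply cderiv_mult; [now apply Cderive_cderiv|].
    apply (cderiv_comp cexp (fun z => - H z)%C); [apply cderiv_cexp|].
    apply (cderiv_ext (fun z => (-1) * H z)%C); [intros; ring|]. apply cderiv_scal, HH.
  - transitivity (Cderive F z * cexp (- H z) * (1 - F z * Fi z))%C; [ring|]. rewrite Hu. ring. }
exists H, (F 0 * cexp (- H 0))%C. split; [exact HH|split].
- intros E. destruct (Cmult_integral _ _ E) as [E'|E'].
  + assert (G := Hu 0). rewrite E', Cmult_0_l in G. apply (f_equal fst) in G. simpl in G. lra.
  + exact (cexp_neq0 _ E').
- intros z. rewrite <- (K' z). transitivity (F z * (cexp (H z) * cexp (- H z)))%C; [|ring].
  rewrite cexp_opp. ring.
Qed.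

(** Borel-Caratheodory for [log F], which is simpler here because [log |F|] is bounded
    on both sides. *)
Theorem log_derivative_bound (F Fi : C -> C) (a : C) (r M : R) :
  entire F -> entire Fi -> (forall z, F z * Fi z = 1)%C -> 0 <= r ->
  (forall z, Cmod (z - a)%C <= r -> Cmod (F z) <= exp M /\ Cmod (Fi z) <= exp M) ->
  r * Cmod (Cderive F a * Fi a)%C <= 4 * M.
Proof.
intros HF HFi Hu Hr HM.
destruct (unit_log F Fi HF HFi Hu) as [H [c [HH [Hc EF]]]].
assert (Hc0 : 0 < Cmod c) by now apply Cmod_gt_0.
set (L := fun z => (Cderive F z * Fi z)%C) in *.
assert (HL : entire L) by (apply entire_mult; [now apply Cderive_entire|exact HFi]).
assert (HHe : entire H) by (apply (entire_intro H L HH)).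
assert (Hre : forall z, Cmod (z - a)%C <= r -> Rabs (ln (Cmod c) + Re (H z)) <= M).
{ intros z Hz. destruct (HM z Hz) as [B1 B2].
  assert (E1 : Cmod (F z) = exp (ln (Cmod c) + Re (H z))).
  { rewrite EF, Cmod_mult, Cmod_cexp, exp_plus, exp_ln by exact Hc0. reflexivity. }
  assert (E2 : Cmod (F z) * Cmod (Fi z) = 1) by (rewrite <- Cmod_mult, Hu; apply Cmod_1).
  rewrite E1 in B1, E2. set (x := ln (Cmod c) + Re (H z)) in *.
  assert (Hx : 0 < exp x) by apply exp_pos. 
  assert (X1 : x <= M). { apply Rnot_lt_le. intros Hlt. apply exp_increasing in Hlt. lra. }
  assert (X2 : - x <= M).
  { apply Rnot_lt_le. intros Hlt. apply exp_increasing in Hlt. rewrite exp_Ropp in Hlt.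
    assert (Cmod (Fi z) = / exp x).
    { apply Rmult_eq_reg_l with (exp x); [|lra]. rewrite E2. field. lra. }
    lra. }
  apply Rabs_le_between. lra. }
(* The mean of H against the conjugate of [circ] is r F'/F at a, and by [E2] the mean against [circ]
   vanishes. Adding the conjugate of the latter replaces H by 2 Re H, which [Hre] controls up to the
   constant 2 ln |c|; constants have mean zero against the conjugate of [circ]. *)
assert (E1 := cauchy_formula_C1 H L a r HL HH).
destruct (entire_primitive H HHe) as [K HK].
assert (Hcc : forall z, ccont H z) by (intros z; now apply entire_ccont).
assert (E2 := circle_integral K H a r HK Hcc).
assert (Cr : forall t, rcont (fun t => H (a + r * circ t)%C) t) by (intros t; now apply rcont_circle).
assert (C1 : forall t, rcont (fun t => H (a + r * circ t) * Cconj (circ t))%C t).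
{ intros t. apply cont_mult; [apply Cr|apply rcont_circ_conj]. }
assert (C2 : forall t, rcont (fun t => H (a + r * circ t) * circ t)%C t).
{ intros t. apply cont_mult; [apply Cr|apply rcont_circ]. }
(* For r = 0 the factor r in [E2] cannot be cancelled; the claim is then just 0 <= M. *)
destruct Hr as [Hr|Hr].
2:{ assert (G := Hre a). replace (a - a)%C with (RtoC 0) in G by ring. rewrite Cmod_0 in G.
    assert (G' := Rle_trans _ _ _ (Rabs_pos _) (G (Req_le _ _ Hr))). rewrite <- Hr. lra. }
destruct (Cmult_integral _ _ E2) as [E2'|E2']; [apply RtoC_inj in E2'; lra|].
assert (E3 : CInt (fun t => Cconj (H (a + r * circ t) * circ t)%C) = 0).
{ rewrite CInt_conj, E2' by exact C2. apply injective_projections; simpl; ring. }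
set (k := RtoC (2 * ln (Cmod c))).
assert (E4 : CInt (fun t => RtoC (2 * (ln (Cmod c) + Re (H (a + r * circ t)%C))) * Cconj (circ t))%C
  = (r * L a)%C).
{ rewrite <- E1.
  rewrite (CInt_ext _ (fun t => k * Cconj (circ t) + (H (a + r * circ t) * Cconj (circ t) +
    Cconj (H (a + r * circ t) * circ t)))%C).
  - rewrite CInt_plus.
    + rewrite CInt_scal by apply rcont_circ_conj. rewrite CInt_circ_conj.
      rewrite CInt_plus; [|exact C1|intros t; apply cont_conj, C2].
      rewrite E3. ring.
    + intros t. apply cont_mult; [apply cont_const|apply rcont_circ_conj].
    + intros t. apply cont_plus; [apply C1|apply cont_conj, C2].
  - intros t _. unfold k. destruct (H (a + r * circ t)%C) as [x y]. destruct (circ t) as [p q].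
    unfold Re. apply injective_projections; simpl; ring. }
replace r with (Cmod r) at 1 by (rewrite Cmod_R; apply Rabs_right; lra).
change (Cderive F a * Fi a)%C with (L a). rewrite <- Cmod_mult, <- E4.
replace (4 * M) with (2 * (2 * M)) by ring.
apply CInt_bound.
- intros t. apply cont_mult; [|apply rcont_circ_conj].
  apply (cont_pair (fun t => 2 * (ln (Cmod c) + Re (H (a + r * circ t)%C))) (fun _ => 0));
    [|apply continuous_const].
  apply (@continuous_mult R_UniformSpace R_AbsRing); [apply continuous_const|].
  apply (@continuous_plus R_UniformSpace R_AbsRing R_NormedModule); [apply continuous_const|].
  apply (cont_Re (fun t => H (a + r * circ t)%C)), Cr.
- intros t _.
  rewrite Cmod_mult, Cmod_conj, Cmod_circ, Rmult_1_r, Cmod_R, Rabs_mult, (Rabs_right 2) by lra.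
  apply Rmult_le_compat_l; [lra|]. apply Hre.
  replace (a + r * circ t - a)%C with (r * circ t)%C by ring.
  rewrite Cmod_mult, Cmod_circ, Cmod_R, Rabs_right; lra.
Qed.

(** * Pell equations over entire functions *)

(** The threshold r0 is traded for a larger constant by using the bound at radius r0 r, which is at
    least both r0 and r. *)
Lemma in_H_growth (rho alpha : R) (f : C -> C) : 0 <= rho -> rho < alpha -> in_H rho f ->
  exists K, 0 <= K /\ forall r z, 1 <= r -> Cmod z <= r -> Cmod (f z) <= exp (K * Rpower r alpha).
Proof.
intros Hrho Ha [Ef Of].
destruct (proj1 (order_le_iff f rho Hrho Ef) Of alpha Ha) as [K [r0 [HK [Hr0 H]]]].
exists (K * Rpower r0 alpha). split.
{ apply Rmult_le_pos; [exact HK|left; apply exp_pos]. }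
intros r z Hr Hz. rewrite Rmult_assoc, Rpower_mult_distr by lra. apply H; nra.
Qed.

Lemma in_H_minus_one (rho : R) (f : C -> C) : 0 <= rho -> in_H rho f -> in_H rho (fun z => f z - 1)%C.
Proof.
intros Hrho Hf.
exact (in_H_plus rho f (fun _ => - RtoC 1)%C Hrho Hf (in_H_const rho (- (1))%C Hrho)).
Qed.

(** A finite-order case of Picard's little theorem. The function p = tau'/(tau (tau - 1)) =
    tau'/(tau - 1) - tau'/tau has polynomial growth. If p = 0, then tau' = 0. Otherwise |p| is
    bounded below near infinity, so tau, the quotient of tau'/(tau - 1) by p, grows polynomially; it
    is then bounded away from 0 near infinity, and its inverse [b] is constant by Liouville. *)
Lemma two_units_const (rho : R) (tau a b : C -> C) : 0 <= rho ->
  in_H rho tau -> in_H rho a -> in_H rho b ->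
  (forall z, tau z * b z = 1)%C -> (forall z, (tau z - 1) * a z = 1)%C ->
  forall z, tau z = tau 0.
Proof.
intros Hrho Ht Ha Hb Eb Ea.
destruct (nfloor_ex rho Hrho) as [k0 [_ Hk0]]. set (k := S k0).
assert (Hk : rho < INR k) by (unfold k; rewrite S_INR; exact Hk0).
assert (Ht1 := in_H_minus_one rho tau Hrho Ht).
assert (Gr : forall F Fi, in_H rho F -> in_H rho Fi -> (forall z, F z * Fi z = 1)%C ->
  exists K, 0 <= K /\ forall z, Cmod (Cderive F z * Fi z)%C <= K * (1 + Cmod z) ^ k).
{ intros F Fi HF HFi Hu.
  destruct (in_H_growth rho (INR k) F Hrho Hk HF) as [K1 [HK1 H1]].
  destruct (in_H_growth rho (INR k) Fi Hrho Hk HFi) as [K2 [HK2 H2]].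
  exists (4 * ((K1 + K2) * 2 ^ k)). split.
  { assert (0 < 2 ^ k) by (apply pow_lt; lra). nra. }
  intros z. assert (Gz := Cmod_ge_0 z).
  (* The unit disc about z lies within |w| <= 2(1 + |z|); [K1 + K2] gives one exponent for both F
     and its inverse. *)
  assert (E := log_derivative_bound F Fi z 1 ((K1 + K2) * (2 * (1 + Cmod z)) ^ k)
    (proj1 HF) (proj1 HFi) Hu Rle_0_1).
  rewrite Rmult_1_l, Rpow_mult_distr in E.
  replace (4 * ((K1 + K2) * 2 ^ k) * (1 + Cmod z) ^ k)
    with (4 * ((K1 + K2) * (2 ^ k * (1 + Cmod z) ^ k))) by ring.
  apply E. intros w Hw.
  assert (Hw' : Cmod w <= 2 * (1 + Cmod z)).
  { assert (T := Cmod_triangle (w - z)%C z). replace (w - z + z)%C with w in T by ring. lra. }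
  assert (Hr : 1 <= 2 * (1 + Cmod z)) by lra.
  rewrite <- Rpow_mult_distr, <- Rpower_pow by lra.
  assert (HP : 0 < Rpower (2 * (1 + Cmod z)) (INR k)) by apply exp_pos.
  split; (eapply Rle_trans; [first [apply H1|apply H2]; eassumption|]); apply exp_le_exp;
  apply Rmult_le_compat_r; lra. }
destruct (Gr tau b Ht Hb Eb) as [K1 [HK1 G1]].
destruct (Gr _ a Ht1 Ha Ea) as [K2 [HK2 G2]].
assert (Et : entire tau) by apply Ht. assert (Eea : entire a) by apply Ha.
assert (Eeb : entire b) by apply Hb.
assert (ED : forall z, Cderive (fun z => tau z - 1)%C z = Cderive tau z).
{ intros z. apply Cderive_eq; [apply Ht1|].
  eapply cderiv_eq; [apply cderiv_minus; [now apply Cderive_cderiv|apply cderiv_const]|]. ring. }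
set (p := fun z => (Cderive tau z * (a z * b z))%C).
assert (Ep : entire p).
{ apply entire_mult; [now apply Cderive_entire|now apply entire_mult]. }
assert (Hp : forall z, p z = (Cderive tau z * a z - Cderive tau z * b z)%C).
{ intros z. unfold p.
  assert (E1 := Ea z). assert (E2 := Eb z).
  transitivity (Cderive tau z * (a z * (tau z * b z) - ((tau z - 1) * a z) * b z))%C; [ring|].
  rewrite E1, E2. ring. }
assert (Bp : forall z, Cmod (p z) <= (K1 + K2) * (1 + Cmod z) ^ k).
{ intros z. rewrite Hp. unfold Cminus. eapply Rle_trans; [apply Cmod_triangle|]. rewrite Cmod_opp.
  specialize (G1 z). specialize (G2 z). rewrite ED in G2. lra. }
destruct (classic (exists z, p z <> 0)) as [Hn|Hn].
2:{ apply Cderive_zero_const; [exact Et|]. intros z.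
    assert (E : p z = 0) by (apply NNPP; intros H; apply Hn; now exists z).
    transitivity (Cderive tau z * ((tau z - 1) * a z) * (tau z * b z))%C.
    - rewrite Ea, Eb. ring.
    - transitivity (p z * (tau z - 1) * tau z)%C; [unfold p; ring|]. rewrite E. ring. }
destruct (poly_growth_lower_bound k p _ Ep Bp Hn) as [c [r [Hc Hr]]].
assert (Hpt : forall z, (p z * tau z = Cderive tau z * a z)%C).
{ intros z. unfold p. transitivity (Cderive tau z * a z * (tau z * b z))%C; [ring|]. rewrite Eb.
  ring. }
destruct (entire_bounded tau r Et) as [B HB].
assert (Htau : forall z, Cmod (tau z) <= (K2 / c + Rmax B 0) * (1 + Cmod z) ^ k).
{ intros z. assert (B1 := Rmax_l B 0). assert (B2 := Rmax_r B 0).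
  assert (HK2c : 0 <= K2 / c) by (apply Rdiv_le_0_compat; lra).
  assert (Hpow : 1 <= (1 + Cmod z) ^ k) by (apply pow_R1_Rle; assert (G := Cmod_ge_0 z); lra).
  destruct (Rle_or_lt r (Cmod z)) as [Hz|Hz].
  - specialize (Hr z Hz). specialize (G2 z). rewrite ED, <- Hpt, Cmod_mult in G2.
    assert (T : c * Cmod (tau z) <= K2 * (1 + Cmod z) ^ k).
    { eapply Rle_trans; [|exact G2]. apply Rmult_le_compat_r; [apply Cmod_ge_0|exact Hr]. }
    apply Rle_trans with (K2 / c * (1 + Cmod z) ^ k); [|nra].
    apply Rmult_le_reg_l with c; [exact Hc|]. eapply Rle_trans; [exact T|]. right. field. lra.
  - specialize (HB z (Rlt_le _ _ Hz)). nra. }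
assert (Hn0 : exists z, tau z <> 0).
{ exists 0. intros E. assert (G := Eb 0). rewrite E, Cmult_0_l in G. apply (f_equal fst) in G.
  simpl in G. lra. }
destruct (poly_growth_lower_bound k tau _ Et Htau Hn0) as [c' [r' [Hc' Hr']]].
destruct (entire_bounded b r' Eeb) as [B' HB'].
assert (Hbc : forall z, b z = b 0).
{ apply (Liouville b (Rmax (/ c') B') Eeb). intros z.
  destruct (Rle_or_lt r' (Cmod z)) as [Hz|Hz].
  - eapply Rle_trans; [|apply Rmax_l]. specialize (Hr' z Hz).
    assert (E : Cmod (tau z) * Cmod (b z) = 1) by (rewrite <- Cmod_mult, Eb; apply Cmod_1).
    apply Rmult_le_reg_l with c'; [exact Hc'|]. rewrite Rinv_r by lra. rewrite <- E.
    apply Rmult_le_compat_r; [apply Cmod_ge_0|exact Hr'].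
  - eapply Rle_trans; [|apply Rmax_r]. apply HB'. lra. }
intros z. transitivity (tau z * (tau 0 * b 0))%C; [rewrite Eb; ring|].
rewrite <- (Hbc z). transitivity (tau 0 * (tau z * b z))%C; [ring|]. rewrite Eb. ring.
Qed.

(** * Hyperbolic functions and Chebyshev polynomials *)

Definition ch (z : C) : C := ((cexp z + cexp (- z)) / 2)%C.
Definition sh (z : C) : C := ((cexp z - cexp (- z)) / 2)%C.

Lemma C2_neq0 : RtoC 2 <> 0.
Proof. intros H. apply RtoC_inj in H. lra. Qed.

Lemma ch_sh_sqr (z : C) : (ch z * ch z - sh z * sh z = 1)%C.
Proof.
unfold ch, sh. transitivity (cexp z * cexp (- z))%C; [field; apply C2_neq0|apply cexp_opp].
Qed.

Lemma ch_plus (a b : C) : ch (a + b)%C = (ch a * ch b + sh a * sh b)%C.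
Proof.
unfold ch, sh. replace (- (a + b))%C with (- a + - b)%C by ring. rewrite !cexp_plus.
field; apply C2_neq0.
Qed.

Lemma sh_plus (a b : C) : sh (a + b)%C = (sh a * ch b + ch a * sh b)%C.
Proof.
unfold ch, sh. replace (- (a + b))%C with (- a + - b)%C by ring. rewrite !cexp_plus.
field; apply C2_neq0.
Qed.

Lemma ch_0 : ch 0 = 1.
Proof. unfold ch. replace (- 0)%C with (RtoC 0) by ring. rewrite cexp_0. field; apply C2_neq0. Qed.

Lemma sh_0 : sh 0 = 0.
Proof. unfold sh. replace (- 0)%C with (RtoC 0) by ring. field; apply C2_neq0. Qed.

Lemma cderiv_cexp_opp (z : C) : cderiv (fun z => cexp (- z)) z (- cexp (- z))%C.
Proof.
eapply cderiv_eq.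
- apply (cderiv_comp cexp (fun z => - z)%C); [apply cderiv_cexp|].
  apply (cderiv_ext (fun z => (-1) * z)%C); [intros; ring|apply cderiv_scal, cderiv_id].
- ring.
Qed.

Lemma cderiv_ch (z : C) : cderiv ch z (sh z).
Proof.
unfold ch, sh.
apply (cderiv_ext (fun z => / 2 * (cexp z + cexp (- z)))%C); [intros; unfold Cdiv; ring|].
eapply cderiv_eq; [apply cderiv_scal, cderiv_plus; [apply cderiv_cexp|apply cderiv_cexp_opp]|].
unfold Cdiv. ring.
Qed.

Lemma cderiv_sh (z : C) : cderiv sh z (ch z).
Proof.
unfold ch, sh.
apply (cderiv_ext (fun z => / 2 * (cexp z - cexp (- z)))%C); [intros; unfold Cdiv; ring|].
eapply cderiv_eq; [apply cderiv_scal, cderiv_minus; [apply cderiv_cexp|apply cderiv_cexp_opp]|].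
unfold Cdiv. ring.
Qed.

Lemma Cmod_cexp_le (z : C) : Cmod (cexp z) <= exp (Rabs (Re z)) /\ Cmod (cexp (- z)) <= exp (Rabs (Re z)).
Proof.
rewrite !Cmod_cexp. split; apply exp_le_exp; [apply Rle_abs|].
rewrite <- Rabs_Ropp. apply (Rle_trans _ (- Re z)); [right; reflexivity|apply Rle_abs].
Qed.

Lemma Cmod_ch_le (z : C) : Cmod (ch z) <= exp (Rabs (Re z)).
Proof.
unfold ch. rewrite Cmod_half. destruct (Cmod_cexp_le z).
assert (T := Cmod_triangle (cexp z) (cexp (- z))). lra.
Qed.

Lemma Cmod_sh_le (z : C) : Cmod (sh z) <= exp (Rabs (Re z)).
Proof.
unfold sh. rewrite Cmod_half. destruct (Cmod_cexp_le z).
assert (T := Cmod_triangle (cexp z) (- cexp (- z))%C). rewrite Cmod_opp in T.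
change (cexp z + - cexp (- z))%C with (cexp z - cexp (- z))%C in T. lra.
Qed.

(** For |Re z| >= 1 the smaller exponential is at most half of the larger. This keeps away from the
    zeros of sinh, all on the imaginary axis, and permits division by [sh] in [E_ch_zero]. *)
Lemma Cmod_sh_ge (z : C) : 1 <= Rabs (Re z) -> exp (Rabs (Re z)) / 4 <= Cmod (sh z).
Proof.
intros H. unfold sh. rewrite Cmod_half.
assert (E : Rabs (exp (Re z) - exp (- Re z)) <= Cmod (cexp z - cexp (- z))%C).
{ assert (T := Cmod_sub_abs (cexp z) (cexp (- z))). rewrite !Cmod_cexp in T. exact T. }
assert (X : forall y, 1 <= y -> exp (- y) <= exp y / 2).
{ intros y Hy. assert (G : 2 <= exp y) by (assert (G := exp_ineq1_le y); lra).
  rewrite exp_Ropp. assert (/ exp y <= / 2) by (apply Rinv_le_contravar; lra). lra. }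
destruct (Rle_or_lt 0 (Re z)) as [Hz|Hz].
- rewrite Rabs_right in H |- * by lra. specialize (X _ H).
  rewrite Rabs_right in E by (assert (G := exp_pos (Re z)); lra). lra.
- rewrite Rabs_left in H |- * by lra. specialize (X _ H). rewrite Ropp_involutive in X.
  rewrite Rabs_left1 in E by (assert (G := exp_pos (- Re z)); lra). lra.
Qed.

(** [cheb n] is [(T_n, U_(n-1))] in terms of the Chebyshev polynomials of both kinds. *)
Fixpoint cheb (n : nat) (z : C) : C * C :=
  match n with
  | O => (RtoC 1, RtoC 0)
  | S n => ((z * fst (cheb n z) + (z * z - 1) * snd (cheb n z))%C,
            (fst (cheb n z) + z * snd (cheb n z))%C)
  end.

(** The recursion of [cheb] is the pair of addition formulas for s + ns, with z^2 - 1 standing for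
    sinh^2. *)
Lemma cheb_ch (n : nat) (s : C) :
  fst (cheb n (ch s)) = ch (INR n * s)%C /\ (sh s * snd (cheb n (ch s)))%C = sh (INR n * s)%C.
Proof.
assert (E := ch_sh_sqr s).
assert (E' : (ch s * ch s - 1 = sh s * sh s)%C).
{ transitivity (ch s * ch s - (ch s * ch s - sh s * sh s))%C; [now rewrite E|ring]. }
induction n as [|n [IH1 IH2]].
- simpl. replace (0 * s)%C with (RtoC 0) by ring. rewrite ch_0, sh_0. split; [reflexivity|ring].
- rewrite S_INR, RtoC_plus. replace ((INR n + 1) * s)%C with (s + INR n * s)%C by ring.
  rewrite ch_plus, sh_plus, <- IH1, <- IH2. simpl. rewrite E'. split; ring.
Qed.

Lemma cheb_entire (n : nat) : entire (fun z => fst (cheb n z)) /\ entire (fun z => snd (cheb n z)).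
Proof.
induction n as [|n [IH1 IH2]]; simpl.
- split; apply entire_const.
- split; apply entire_plus; trivial; apply entire_mult; trivial; try apply entire_id.
  apply entire_plus; [apply entire_mult; apply entire_id|apply entire_const].
Qed.

Definition pi_i : C := (0, PI).

(** * Rigidity of Pell solutions of order less than [d] *)

Section Pell.
Variables (rho : R) (d : nat) (c : C) (X V A B : C -> C).
Let P (z : C) : C := fst (cheb d z).
Let U (z : C) : C := snd (cheb d z).
Hypotheses (Hrho : 0 <= rho) (Hd : rho < INR d).
Hypotheses (HX : in_H rho X) (HV : in_H rho V) (HA : entire A) (HB : entire B).
Hypothesis Pell_eq : forall z, (X z * X z = 1 + (P z * P z - 1) * (V z * V z))%C.
Hypothesis X_eq : forall z, (X z = 1 + (P z * P z - 1) * A z)%C.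
Hypothesis V_eq : forall z, (V z = P z * c + (P z * P z - 1) * B z)%C.

(** The square root of P^2-1 branches in z; after z = cosh s it is the entire function [S], so the
    Pell equation factors as F Fi = 1. The constant [c] stands for 2t. *)
Let S (s : C) : C := sh (INR d * s)%C.
Let F (s : C) : C := (X (ch s) + S s * V (ch s))%C.
Let Fi (s : C) : C := (X (ch s) - S s * V (ch s))%C.

Lemma P_ch (s : C) : P (ch s) = ch (INR d * s)%C.
Proof. apply cheb_ch. Qed.

Lemma P_sqr (s : C) : (P (ch s) * P (ch s) - 1 = S s * S s)%C.
Proof.
rewrite P_ch. unfold S. rewrite <- (ch_sh_sqr (INR d * s)). ring.
Qed.

Lemma F_Fi (s : C) : (F s * Fi s = 1)%C.
Proof.
unfold F, Fi. assert (E := Pell_eq (ch s)). rewrite P_sqr in E.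
transitivity (X (ch s) * X (ch s) - S s * S s * (V (ch s) * V (ch s)))%C; [ring|]. rewrite E. ring.
Qed.

Lemma cderiv_S (s : C) : cderiv S s (INR d * P (ch s))%C.
Proof.
rewrite P_ch. apply (cderiv_comp sh (fun s => INR d * s)%C).
- apply cderiv_sh.
- eapply cderiv_eq; [apply cderiv_scal, cderiv_id|]. ring.
Qed.

Lemma cderiv_SV (s : C) : cderiv (fun s => S s * V (ch s))%C s
  (INR d * P (ch s) * V (ch s) + S s * (sh s * Cderive V (ch s)))%C.
Proof.
apply (cderiv_mult S (fun s => V (ch s))); [apply cderiv_S|].
apply cderiv_comp; [apply Cderive_cderiv, HV|apply cderiv_ch].
Qed.

Lemma cderiv_Xch (s : C) : cderiv (fun s => X (ch s)) s (sh s * Cderive X (ch s))%C.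
Proof. apply cderiv_comp; [apply Cderive_cderiv, HX|apply cderiv_ch]. Qed.

Let dF (s : C) : C := (sh s * Cderive X (ch s) +
  (INR d * P (ch s) * V (ch s) + S s * (sh s * Cderive V (ch s))))%C.

Lemma cderiv_F (s : C) : cderiv F s (dF s).
Proof. apply cderiv_plus; [apply cderiv_Xch|apply cderiv_SV]. Qed.

Lemma F_entire : entire F.
Proof. exact (entire_intro F dF cderiv_F). Qed.

Lemma Fi_entire : entire Fi.
Proof.
eapply entire_intro. intros s. apply cderiv_minus; [apply cderiv_Xch|apply cderiv_SV].
Qed.

(** This is (F'/F - dc)/(S sh) written without division and as a function of z. The last bracket is
    (PVX - c)/(P^2-1), computed from the congruences; its factor [U] is what remains of S = sh U. *)
Let E (z : C) : C := (Cderive V z * X z - Cderive X z * V z +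
  INR d * U z * (c + P z * B z + P z * V z * A z))%C.

Lemma E_entire : entire E.
Proof.
destruct (cheb_entire d) as [EP EU]. fold P in EP. fold U in EU.
assert (EX : entire X) by apply HX. assert (EV : entire V) by apply HV.
assert (EDX := Cderive_entire X EX). assert (EDV := Cderive_entire V EV).
apply entire_plus; [apply entire_plus|].
- now apply entire_mult.
- apply (entire_intro _ (fun z => - Cderive (fun z => Cderive X z * V z)%C z)%C).
  intros z. apply (cderiv_ext (fun z => (-1) * (Cderive X z * V z))%C); [intros; ring|].
  eapply cderiv_eq; [apply cderiv_scal, Cderive_cderiv; now apply entire_mult|]. ring.
- apply entire_mult; [apply entire_mult; [apply entire_const|exact EU]|].
  apply entire_plus; [apply entire_plus; [apply entire_const|now apply entire_mult]|].
  apply entire_mult; [now apply entire_mult|exact HA].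
Qed.

Lemma log_derivative_F (s : C) : (dF s * Fi s - INR d * c = S s * sh s * E (ch s))%C.
Proof.
assert (Hder : (dF s * Fi s + F s * (sh s * Cderive X (ch s) -
  (INR d * P (ch s) * V (ch s) + S s * (sh s * Cderive V (ch s)))) = 0)%C).
{ apply (cderiv_unique (fun s => F s * Fi s)%C s).
  - apply cderiv_mult; [apply cderiv_F|]. apply cderiv_minus; [apply cderiv_Xch|apply cderiv_SV].
  - apply (cderiv_ext (fun _ => 1)); [intros; symmetry; apply F_Fi|apply cderiv_const]. }
assert (HU : (sh s * U (ch s) = S s)%C) by apply cheb_ch.
assert (HP := P_sqr s). assert (HXs := X_eq (ch s)). assert (HVs := V_eq (ch s)).
rewrite HP in HXs, HVs.
unfold dF, F, Fi, E in *.
set (x := X (ch s)) in *. set (v := V (ch s)) in *. set (p := P (ch s)) in *.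
set (u := U (ch s)) in *.
set (dx := Cderive X (ch s)) in *. set (dv := Cderive V (ch s)) in *. set (a := A (ch s)) in *.
set (b := B (ch s)) in *. set (q := S s) in *. set (h := sh s) in *. set (n := RtoC (INR d)) in *.
(* Half of the derivative of F Fi = 1. It cancels the corresponding terms of dF Fi and leaves n p v
   x + q h (dv x - dx v). *)
assert (H1 : (x * (h * dx) = q * v * (n * p * v + q * (h * dv)))%C).
{ assert (T : (2 * (x * (h * dx) - q * v * (n * p * v + q * (h * dv))) = 0)%C) by (rewrite <- Hder; ring).
  destruct (Cmult_integral _ _ T) as [T'|T']; [now elim C2_neq0|].
  match type of T' with (?l - ?r)%C = _ => replace l with (l - r + r)%C by ring; rewrite T'; ring end. }
(* Modulo q^2 the congruences give x = 1 and v = pc, and p^2 = 1, so p v x is c; the bracket records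
   the exact quotient. *)
assert (H2 : (p * v * x = c + q * q * (c + p * b + p * v * a))%C).
{ transitivity (p * v + q * q * (p * v * a))%C.
  - rewrite HXs at 1. ring.
  - rewrite HVs at 1. transitivity ((p * p - 1) * c + c + q * q * (p * b + p * v * a))%C; [ring|].
    rewrite HP. ring. }
transitivity ((x * (h * dx) - q * v * (n * p * v + q * (h * dv))) + n * (p * v * x) + q * h * (dv * x - dx * v) - n * c)%C; [ring|].
rewrite H1, H2.
transitivity (q * h * (dv * x - dx * v) + q * n * (h * u) * (c + p * b + p * v * a))%C; [rewrite HU|]; ring.
Qed.

(** An exponent strictly between the two: rho < alpha gives the growth bound, alpha < d the decay of
    E(cosh s). *)
Let alpha : R := (rho + INR d) / 2.

Lemma F_growth : exists K, 0 <= K /\ forall s,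
  Cmod (F s) <= exp (K * exp (alpha * Rabs (Re s))) /\
  Cmod (Fi s) <= exp (K * exp (alpha * Rabs (Re s))).
Proof.
assert (Ha : rho < alpha) by (unfold alpha; lra).
destruct (in_H_growth rho alpha X Hrho Ha HX) as [K1 [HK1 H1]].
destruct (in_H_growth rho alpha V Hrho Ha HV) as [K2 [HK2 H2]].
assert (Hda : 0 <= INR d / alpha) by (apply Rdiv_le_0_compat; lra).
(* [K1] bounds X; [K2] and d/alpha bound the product S V, since dx <= (d/alpha) exp(alpha x); the 1
   pays for adding two terms, as 2 <= exp m. *)
exists (K1 + K2 + 1 + INR d / alpha). split; [lra|]. intros s.
set (x := Rabs (Re s)). assert (Hx : 0 <= x) by apply Rabs_pos.
assert (Hr : 1 <= exp x) by (assert (G := exp_ineq1_le x); lra).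
assert (Hpow : Rpower (exp x) alpha = exp (alpha * x)) by (unfold Rpower; now rewrite ln_exp).
set (m := exp (alpha * x)) in *.
assert (Hm : 1 + alpha * x <= m) by apply exp_ineq1_le.
assert (Hax : 0 <= alpha * x) by (apply Rmult_le_pos; lra).
assert (HKm : 0 <= K1 * m /\ 0 <= K2 * m) by (split; apply Rmult_le_pos; lra).
specialize (H1 (exp x) (ch s) Hr (Cmod_ch_le s)). specialize (H2 (exp x) (ch s) Hr (Cmod_ch_le s)).
rewrite Hpow in H1, H2.
assert (HS : Cmod (S s) <= exp (INR d * x)).
{ eapply Rle_trans; [apply Cmod_sh_le|]. apply exp_le_exp. right.
  replace (Re (INR d * s)%C) with (INR d * Re s) by (unfold Re; simpl; ring).
  rewrite Rabs_mult, (Rabs_right (INR d)); [reflexivity|]. apply Rle_ge, pos_INR. }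
assert (Hsum : Cmod (X (ch s)) + Cmod (S s * V (ch s))%C <= exp ((K1 + K2 + 1 + INR d / alpha) * m)).
{ rewrite Cmod_mult.
  assert (Y1 : 1 <= exp (K1 * m)) by (assert (G := exp_ineq1_le (K1 * m)); lra).
  assert (Y2 : 1 <= exp (K2 * m)) by (assert (G := exp_ineq1_le (K2 * m)); lra).
  assert (Y3 : 1 <= exp (INR d * x)) by (assert (G := exp_ineq1_le (INR d * x)); assert (G' := pos_INR d); nra).
  assert (Y4 : 2 <= exp m) by (assert (G := exp_ineq1_le m); lra).
  assert (Y5 : exp (INR d * x) <= exp (INR d / alpha * m)).
  { apply exp_le_exp. replace (INR d * x) with (INR d / alpha * (alpha * x)) by (field; lra).
    apply Rmult_le_compat_l; lra. }
  replace ((K1 + K2 + 1 + INR d / alpha) * m) with (K1 * m + K2 * m + INR d / alpha * m + m) by ring.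
  rewrite !exp_plus.
  set (e1 := exp (K1 * m)) in *. set (e2 := exp (K2 * m)) in *.
  set (e3 := exp (INR d / alpha * m)) in *.
  assert (Z1 : Cmod (S s) * Cmod (V (ch s)) <= e3 * e2).
  { apply Rmult_le_compat; try apply Cmod_ge_0; lra. }
  assert (Z2 : 1 <= e3 * e2) by nra.
  assert (Z3 : e1 <= e1 * (e3 * e2)) by nra. assert (Z4 : e3 * e2 <= e1 * (e3 * e2)) by nra.
  apply Rle_trans with (e1 * (e3 * e2) * 2); [lra|].
  replace (e1 * e2 * e3 * exp m) with (e1 * (e3 * e2) * exp m) by ring.
  apply Rmult_le_compat_l; [nra|exact Y4]. }
split; (eapply Rle_trans; [|exact Hsum]); unfold F, Fi, Cminus; (eapply Rle_trans; [apply Cmod_triangle|]);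
rewrite ?Cmod_opp; lra.
Qed.

Lemma E_ch_zero (s : C) : E (ch s) = 0.
Proof.
assert (Hd0 : (1 <= d)%nat). { destruct d; [simpl in Hd; lra|lia]. }
assert (Hd1 : 1 <= INR d) by (apply (le_INR 1); exact Hd0).
destruct F_growth as [K [HK HF]].
assert (Ha : 0 < alpha < INR d) by (unfold alpha; lra).
(* Taking the logarithmic derivative turns the double exponential bound into a single one; a unit
   disc moves Re s by at most 1, whence the factor exp(alpha). *)
assert (HL : forall s, Cmod (dF s * Fi s)%C <= 4 * (K * exp alpha) * exp (alpha * Rabs (Re s))).
{ intros w.
  assert (G := log_derivative_bound F Fi w 1 (K * exp alpha * exp (alpha * Rabs (Re w)))
    F_entire Fi_entire F_Fi Rle_0_1).
  rewrite (Cderive_eq F w (dF w) F_entire (cderiv_F w)), Rmult_1_l in G.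
  rewrite Rmult_assoc. apply G. intros y Hy.
  assert (Hre : K * exp (alpha * Rabs (Re y)) <= K * exp alpha * exp (alpha * Rabs (Re w))).
  { rewrite Rmult_assoc, <- exp_plus. apply Rmult_le_compat_l; [exact HK|]. apply exp_le_exp.
    replace (alpha + alpha * Rabs (Re w)) with (alpha * (1 + Rabs (Re w))) by ring.
    apply Rmult_le_compat_l; [lra|].
    assert (T := Rabs_triang (Re (y - w)%C) (Re w)).
    replace (Re (y - w)%C + Re w) with (Re y) in T by (unfold Re; simpl; ring).
    assert (T' := re_le_Cmod (y - w)%C). lra. }
  destruct (HF y). split; (eapply Rle_trans; [eassumption|]); now apply exp_le_exp. }
set (C2 := 4 * (K * exp alpha) + Cmod (INR d * c)%C).
assert (HC2 : 0 <= C2).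
{ unfold C2. assert (G := Cmod_ge_0 (INR d * c)%C). assert (G' := exp_pos alpha). nra. }
(* [Cmod_sh_ge] is applied to both sinh(ds) and sinh(s), giving 16 = 4 * 4; of the growth of sinh(s)
   only exp |Re s| >= 1 is kept. *)
assert (HG : forall s, 1 <= Rabs (Re s) ->
  Cmod (E (ch s)) <= 16 * C2 * exp ((alpha - INR d) * Rabs (Re s))).
{ intros w Hw. specialize (HL w). set (x := Rabs (Re w)) in *.
  assert (Hsh := Cmod_sh_ge w Hw). fold x in Hsh.
  assert (HSge : exp (INR d * x) / 4 <= Cmod (S w)).
  { assert (Hre : Rabs (Re (INR d * w)%C) = INR d * x).
    { replace (Re (INR d * w)%C) with (INR d * Re w) by (unfold Re; simpl; ring).
      rewrite Rabs_mult, (Rabs_right (INR d)); [reflexivity|lra]. }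
    rewrite <- Hre. apply Cmod_sh_ge. rewrite Hre. nra. }
  assert (Hle : Cmod (S w * sh w * E (ch w))%C <= C2 * exp (alpha * x)).
  { rewrite <- log_derivative_F. unfold Cminus. eapply Rle_trans; [apply Cmod_triangle|].
    rewrite Cmod_opp.
    assert (1 <= exp (alpha * x)) by (assert (G := exp_ineq1_le (alpha * x)); nra).
    assert (G := Cmod_ge_0 (INR d * c)%C). unfold C2. nra. }
  rewrite !Cmod_mult in Hle.
  replace ((alpha - INR d) * x) with (alpha * x + - (INR d * x)) by ring.
  rewrite exp_plus, exp_Ropp.
  set (ed := exp (INR d * x)) in *. set (ea := exp (alpha * x)) in *.
  assert (Hed : 0 < ed) by apply exp_pos.
  assert (Hx1 : 1 <= exp x) by (assert (G := exp_ineq1_le x); lra).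
  assert (Hg := Cmod_ge_0 (E (ch w))).
  assert (Hp : ed / 16 <= Cmod (S w) * Cmod (sh w)).
  { replace (ed / 16) with (ed / 4 * (1 / 4)) by field. apply Rmult_le_compat; lra. }
  assert (Hq : ed / 16 * Cmod (E (ch w)) <= C2 * ea).
  { eapply Rle_trans; [|exact Hle]. apply Rmult_le_compat_r; assumption. }
  apply Rmult_le_reg_l with (ed / 16); [lra|]. eapply Rle_trans; [exact Hq|]. right. field. lra. }
(* The strip |Re s| < 1 is unbounded, but [ch] maps it into the disc of radius e, where E is
   bounded. *)
destruct (entire_bounded E (exp 1) E_entire) as [M HM].
assert (Hconst : forall s, E (ch s) = E (ch 0)).
{ apply (Liouville (fun s => E (ch s)) (Rmax M (16 * C2))).
  - apply entire_comp; [apply E_entire|]. exact (entire_intro ch sh cderiv_ch).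
  - intros w. destruct (Rle_or_lt 1 (Rabs (Re w))) as [Hw|Hw].
    + eapply Rle_trans; [apply (HG w Hw)|]. eapply Rle_trans; [|apply Rmax_r].
      rewrite <- (Rmult_1_r (16 * C2)) at 2. apply Rmult_le_compat_l; [lra|].
      rewrite <- exp_0. apply exp_le_exp. nra.
    + eapply Rle_trans; [|apply Rmax_l]. apply HM.
      eapply Rle_trans; [apply Cmod_ch_le|]. apply exp_le_exp. lra. }
rewrite Hconst. apply Cmod_eq_0. apply Rle_antisym; [|apply Cmod_ge_0].
apply Rnot_lt_le. intros Hpos. set (g := Cmod (E (ch 0))) in *.
(* The decay bound at this x says g exp((d - alpha)x) <= 16 C2, whereas exp y >= 1 + y makes the
   left side at least g + g(d - alpha) + 16 C2. *)
set (x := 1 + 16 * C2 / (g * (INR d - alpha))).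
assert (Hgd : 0 < g * (INR d - alpha)) by nra.
assert (Hx : 1 <= x).
{ unfold x. assert (0 <= 16 * C2 / (g * (INR d - alpha))) by (apply Rdiv_le_0_compat; lra). lra. }
assert (Hax : Rabs (Re (RtoC x)) = x) by (simpl; apply Rabs_right; lra).
assert (Hx' := HG (RtoC x)). rewrite Hax in Hx'. specialize (Hx' Hx). rewrite Hconst in Hx'.
fold g in Hx'.
replace ((alpha - INR d) * x) with (- ((INR d - alpha) * x)) in Hx' by ring.
rewrite exp_Ropp in Hx'.
assert (He := exp_ineq1_le ((INR d - alpha) * x)).
set (ex := exp ((INR d - alpha) * x)) in *.
assert (Hex : 0 < ex) by apply exp_pos.
assert (Hfin : g * ex <= 16 * C2).
{ apply Rmult_le_reg_r with (/ ex); [now apply Rinv_0_lt_compat|].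
  replace (g * ex * / ex) with g by (field; lra). exact Hx'. }
assert (Hgx : g * ((INR d - alpha) * x) = g * (INR d - alpha) + 16 * C2).
{ unfold x. field. split; [|lra]. intros H. rewrite H in Hgd. lra. }
nra.
Qed.

Lemma Pell_exponential : cexp (c * pi_i)%C = 1.
Proof.
assert (Hd0 : INR d <> 0) by lra.
assert (HL : forall s, cderiv F s (INR d * c * F s)%C).
{ intros s. eapply cderiv_eq; [apply cderiv_F|].
  assert (G := log_derivative_F s). rewrite E_ch_zero in G.
  transitivity ((dF s * Fi s - INR d * c) * F s + INR d * c * F s)%C; [|rewrite G; ring].
  transitivity (dF s * (F s * Fi s))%C; [rewrite F_Fi|]; ring. }
(* Where sinh(ds) vanishes, so does P^2-1 at cosh s, and the congruence for X gives F = X = 1. This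
   is used at s = 0 and s = i pi/d. *)
assert (Hval : forall s, S s = 0 -> F s = 1).
{ intros s Hs. unfold F. rewrite Hs, X_eq, P_sqr, Hs. ring. }
assert (Hd0' : RtoC (INR d) <> 0) by (intros H; apply RtoC_inj in H; lra).
assert (E1 := linear_ode F (INR d * c)%C HL (pi_i / INR d)%C).
rewrite (Hval 0), Cmult_1_l in E1.
2:{ unfold S. rewrite Cmult_0_r. apply sh_0. }
rewrite Hval in E1.
- rewrite E1. f_equal. field. exact Hd0'.
- unfold S. replace (INR d * (pi_i / INR d))%C with pi_i by (field; exact Hd0').
  unfold sh, cexp, pi_i, Re, Im. simpl. rewrite Ropp_0, exp_0, cos_neg, sin_neg, sin_PI.
  replace (_ - _)%C with (RtoC 0); [field; exact C2_neq0|].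
  apply injective_projections; simpl; ring.
Qed.
End Pell.

(** * The formula *)

Lemma cexp_period (t : C) : cexp ((t + t) * pi_i)%C = 1 -> exists n : Z, t = IZR n.
Proof.
intros H. destruct t as [x y].
assert (Hm := f_equal Cmod H). rewrite Cmod_cexp, Cmod_1 in Hm.
rewrite <- exp_0 in Hm. apply exp_inv in Hm.
assert (HPI := PI_RGT_0).
(* The modulus of the exponential is exp(-2 pi y). *)
assert (Hy : y = 0).
{ unfold Re in Hm. simpl in Hm. nra. }
subst y.
apply (f_equal fst) in H. set (w := (((x, 0) + (x, 0)) * pi_i)%C) in *.
change (exp (Re w) * cos (Im w) = 1) in H. rewrite Hm, exp_0, Rmult_1_l in H.
replace (Im w) with (2 * (x * PI)) in H by (unfold w, Im; simpl; ring).
rewrite cos_2a_sin in H.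
assert (Hs : sin (x * PI) = 0) by nra.
apply sin_eq_0_0 in Hs. destruct Hs as [k Hk]. exists k.
apply injective_projections; simpl; [|reflexivity].
apply Rmult_eq_reg_r with PI; lra.
Qed.

Lemma cheb_in_H (rho : R) (n : nat) : 0 <= rho ->
  in_H rho (fun z => fst (cheb n z)) /\ in_H rho (fun z => snd (cheb n z)).
Proof.
intros Hrho. induction n as [|n [IH1 IH2]]; simpl.
- split; now apply in_H_const.
- assert (Hz := in_H_id rho Hrho). split; apply in_H_plus; trivial; apply in_H_mult; trivial.
  exact (in_H_minus_one rho _ Hrho (in_H_mult rho _ _ Hrho Hz Hz)).
Qed.

(** T + U sqrt(P^2-1) is the n-th power of P + sqrt(P^2-1). The congruence concerns T U because the
    formula uses the square of this power, whose second coordinate is 2TU. *)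
Lemma Pell_powers (rho : R) (P : C -> C) (n : nat) : 0 <= rho -> in_H rho P ->
  exists T U B : C -> C, in_H rho T /\ in_H rho U /\ in_H rho B /\ forall z,
    (T z * T z = 1 + (P z * P z - 1) * (U z * U z))%C /\
    (T z * U z = INR n * P z + (P z * P z - 1) * B z)%C.
Proof.
intros Hrho HP.
assert (HD : in_H rho (fun z => P z * P z - 1)%C).
{ exact (in_H_minus_one rho _ Hrho (in_H_mult rho _ _ Hrho HP HP)). }
induction n as [|n (T & U & B & HT & HU & HB & IH)].
- exists (fun _ => 1), (fun _ => 0), (fun _ => 0).
  split; [now apply in_H_const|]. split; [now apply in_H_const|]. split; [now apply in_H_const|].
  intros z. split; simpl; ring.
(* Multiplication by P + sqrt D, where D = P^2-1. The new product is P T^2 + TU + D(2TU + P U^2),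
   and P T^2 = P + D P U^2 by the Pell equation; hence the increment of [B]. *)
- exists (fun z => P z * T z + (P z * P z - 1) * U z)%C, (fun z => T z + P z * U z)%C,
    (fun z => B z + 2 * (T z * U z + P z * (U z * U z)))%C.
  assert (HUU := in_H_mult rho U U Hrho HU HU).
  assert (HPUU := in_H_mult rho _ _ Hrho HP HUU).
  split; [|split; [|split]].
  + exact (in_H_plus rho _ _ Hrho (in_H_mult rho _ _ Hrho HP HT) (in_H_mult rho _ _ Hrho HD HU)).
  + exact (in_H_plus rho _ _ Hrho HT (in_H_mult rho _ _ Hrho HP HU)).
  + exact (in_H_plus rho _ _ Hrho HB (in_H_mult rho _ _ Hrho (in_H_const rho 2 Hrho)
      (in_H_plus rho _ _ Hrho (in_H_mult rho _ _ Hrho HT HU) HPUU))).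
  + intros z. destruct (IH z) as [E1 E2]. split.
    * transitivity ((P z * P z) * (T z * T z) + 2 * P z * (P z * P z - 1) * (T z * U z) +
        (P z * P z - 1) * (P z * P z - 1) * (U z * U z))%C; [ring|].
      transitivity (1 + (P z * P z - 1) * (T z * T z + 2 * P z * (T z * U z) + P z * P z * (U z * U z)))%C; [|ring].
      rewrite E1. ring.
    * rewrite S_INR, RtoC_plus.
      transitivity (P z * (T z * T z) + T z * U z + (P z * P z - 1) *
        (2 * (T z * U z) + P z * (U z * U z)))%C; [ring|].
      rewrite E1, E2 at 1. ring.
Qed.

(** Variables: [0] is the free variable [t], [1] is [-1], [2], [3] are the Pell solution
    [X], [V], [4], [5] are the cofactors [A], [B] of its two congruences, and [6], [7] are
    the inverses of [3t+1] and [3t+2]. *)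
Fixpoint cheb_term (n : nat) : Lz_term * Lz_term :=
  match n with
  | O => (One, Zero)
  | S n => (Add (Mul Zed (fst (cheb_term n)))
                (Mul (Add (Mul Zed Zed) (Var 1)) (snd (cheb_term n))),
            Add (fst (cheb_term n)) (Mul Zed (snd (cheb_term n))))
  end.

Definition int_formula (d : nat) : pos_formula :=
  let P := fst (cheb_term d) in
  let P2 := Add (Mul P P) (Var 1) in
  let t3 := Add (Add (Add (Var 0) (Var 0)) (Var 0)) One in
  And (Eq (Add (Var 1) One) Zero)
  (And (Eq (Mul (Var 2) (Var 2)) (Add One (Mul P2 (Mul (Var 3) (Var 3)))))
  (And (Eq (Var 2) (Add One (Mul P2 (Var 4))))
  (And (Eq (Var 3) (Add (Mul P (Add (Var 0) (Var 0))) (Mul P2 (Var 5))))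
  (And (Eq (Mul t3 (Var 6)) One) (Eq (Mul (Add t3 One) (Var 7)) One))))).

Lemma cheb_term_occurs (n x : nat) :
  (term_occurs x (fst (cheb_term n)) -> x = 1%nat) /\ (term_occurs x (snd (cheb_term n)) -> x = 1%nat).
Proof. induction n as [|n [IH1 IH2]]; simpl; tauto. Qed.

Lemma int_formula_occurs (d x : nat) : pos_occurs x (int_formula d) -> (x <= 7)%nat.
Proof.
destruct (cheb_term_occurs d x) as [H _]. simpl.
assert (H' : term_occurs x (fst (cheb_term d)) -> (x <= 7)%nat) by (intros G; apply H in G; lia).
clear H. intuition lia.
Qed.

(** * Soundness and completeness of the formula *)

Section Satisfaction.
Variables (rho : R) (hrho : 0 <= rho).

Lemma cheb_term_val (w : nat -> H_struct rho hrho) (n : nat) (z : C) :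
  proj1_sig (w 1%nat) z = (- (1))%C ->
  proj1_sig (term_val (H_struct rho hrho) w (fst (cheb_term n))) z = fst (cheb n z) /\
  proj1_sig (term_val (H_struct rho hrho) w (snd (cheb_term n))) z = snd (cheb n z).
Proof.
intros He. induction n as [|n [IH1 IH2]]; simpl; [split; reflexivity|].
rewrite IH1, IH2, He. split; reflexivity.
Qed.

Lemma int_formula_sat (d : nat) (w : nat -> H_struct rho hrho) :
  pos_sat (H_struct rho hrho) w (int_formula d) <->
  forall z, let P := fst (cheb d z) in
    let t := proj1_sig (w 0%nat) z in let X := proj1_sig (w 2%nat) z in
    let V := proj1_sig (w 3%nat) z in
    (proj1_sig (w 1%nat) z = - (1) /\
    X * X = 1 + (P * P - 1) * (V * V) /\
    X = 1 + (P * P - 1) * proj1_sig (w 4%nat) z /\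
    V = P * (t + t) + (P * P - 1) * proj1_sig (w 5%nat) z /\
    (t + t + t + 1) * proj1_sig (w 6%nat) z = 1 /\
    (t + t + t + 1 + 1) * proj1_sig (w 7%nat) z = 1)%C.
Proof.
unfold int_formula. cbn [pos_sat]. rewrite !H_struct_eq.
assert (He : forall z, (proj1_sig (w 1%nat) z + 1 = 0 <-> proj1_sig (w 1%nat) z = - (1))%C).
{ intros z. split; intros H.
  - transitivity (proj1_sig (w 1%nat) z + 1 - 1)%C; [ring|]. rewrite H. ring.
  - rewrite H. ring. }
split.
- intros (H1 & H2 & H3 & H4 & H5 & H6) z.
  (* The value -1 of [Var 1] comes first: only with it do the terms of [cheb_term] evaluate to
     Chebyshev polynomials. *)
  specialize (H1 z). simpl in H1. apply He in H1.
  specialize (H2 z). specialize (H3 z). specialize (H4 z). specialize (H5 z). specialize (H6 z).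
  simpl in H2, H3, H4, H5, H6.
  rewrite (proj1 (cheb_term_val w d z H1)), H1 in *. tauto.
- intros H. repeat split; intros z; destruct (H z) as (H1 & H2 & H3 & H4 & H5 & H6); simpl;
  rewrite ?(proj1 (cheb_term_val w d z H1)), ?H1; trivial. ring.
Qed.

Lemma int_formula_sound (d : nat) (w : nat -> H_struct rho hrho) : rho < INR d ->
  pos_sat (H_struct rho hrho) w (int_formula d) -> exists n : Z, w 0%nat = int_in_H rho hrho n.
Proof.
intros Hd H. rewrite int_formula_sat in H. cbv zeta in H.
set (t := proj1_sig (w 0%nat)) in *. set (X := proj1_sig (w 2%nat)) in *.
set (V := proj1_sig (w 3%nat)) in *. set (A := proj1_sig (w 4%nat)) in *.
set (B := proj1_sig (w 5%nat)) in *. set (a := proj1_sig (w 6%nat)) in *.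
set (b := proj1_sig (w 7%nat)) in *.
assert (Ht : in_H rho t) by apply proj2_sig.
assert (Hconst : forall z, (t z + t z + t z + 1 + 1 = t 0 + t 0 + t 0 + 1 + 1)%C).
(* Here tau = 3t + 2, so tau - 1 = 3t + 1 has the inverse [a] and tau the inverse [b]. *)
{ apply (two_units_const rho (fun z => t z + t z + t z + 1 + 1)%C a b hrho).
  - assert (H1 := in_H_const rho 1 hrho).
    exact (in_H_plus rho _ _ hrho (in_H_plus rho _ _ hrho (in_H_plus rho _ _ hrho
      (in_H_plus rho _ _ hrho Ht Ht) Ht) H1) H1).
  - apply proj2_sig.
  - apply proj2_sig.
  - intros z. apply (H z).
  - intros z. destruct (H z) as (_ & _ & _ & _ & E & _).
    transitivity ((t z + t z + t z + 1) * a z)%C; [ring|exact E]. }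
assert (Ht0 : forall z, t z = t 0).
{ intros z. specialize (Hconst z).
  assert (H3 : RtoC 3 <> 0) by (intros G; apply RtoC_inj in G; lra).
  transitivity (((t z + t z + t z + 1 + 1) - 1 - 1) / 3)%C; [field; exact H3|].
  rewrite Hconst. field; exact H3. }
destruct (cexp_period (t 0)) as [n Hn].
- apply (Pell_exponential rho d (t 0 + t 0)%C X V A B); trivial; try apply proj2_sig.
  + apply (proj2_sig (w 4%nat)).
  + apply (proj2_sig (w 5%nat)).
  + intros z. apply (H z).
  + intros z. apply (H z).
  + intros z. rewrite <- (Ht0 z). apply (H z).
- exists n. apply H_struct_eq. intros z. fold t. rewrite (Ht0 z). exact Hn.
Qed.

(** The witnesses come from the square of the |n|-th power: X = T^2 + (P^2-1)U^2 = 1 + 2(P^2-1)U^2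
    and, up to sign, V = 2TU, so the cofactors are 2U^2 and 2B up to sign. *)
Lemma int_formula_complete (d : nat) (v : nat -> H_struct rho hrho) (n : Z) :
  v 0%nat = int_in_H rho hrho n ->
  pe_sat (H_struct rho hrho) v (Ex_prefix (1 :: 2 :: 3 :: 4 :: 5 :: 6 :: 7 :: nil)%nat (int_formula d)).
Proof.
intros Hv.
destruct (Pell_powers rho (fun z => fst (cheb d z)) (Z.abs_nat n) hrho (proj1 (cheb_in_H rho d hrho)))
  as (T & U & B & HT & HU & HB & E).
(* Negative n are reached by changing the sign of V, which the Pell equation and the congruence for
   X do not see. *)
assert (Hsg : exists s : R, s * s = 1 /\ IZR n = s * INR (Z.abs_nat n)).
{ rewrite INR_IZR_INZ, Zabs2Nat.id_abs. destruct (Z.abs_eq_or_opp n) as [Ha|Ha]; rewrite Ha.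
  - exists 1. split; ring.
  - exists (-1). rewrite opp_IZR. split; ring. }
destruct Hsg as [s [Hs Hn]].
assert (HUU := in_H_mult rho U U hrho HU HU). assert (HTU := in_H_mult rho T U hrho HT HU).
assert (HD : in_H rho (fun z => fst (cheb d z) * fst (cheb d z) - 1)%C).
{ assert (HP := proj1 (cheb_in_H rho d hrho)).
  exact (in_H_minus_one rho _ hrho (in_H_mult rho _ _ hrho HP HP)). }
assert (HA : in_H rho (fun z => 2 * (U z * U z))%C).
{ apply (in_H_mult rho (fun _ => RtoC 2) _ hrho); [now apply in_H_const|exact HUU]. }
assert (HX : in_H rho (fun z => 1 + (fst (cheb d z) * fst (cheb d z) - 1) * (2 * (U z * U z)))%C).
{ exact (in_H_plus rho _ _ hrho (in_H_const rho 1 hrho) (in_H_mult rho _ _ hrho HD HA)). }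
assert (HV : in_H rho (fun z => (2 * s)%R * (T z * U z))%C).
{ exact (in_H_mult rho _ _ hrho (in_H_const rho (2 * s)%R hrho) HTU). }
assert (HB' : in_H rho (fun z => (2 * s)%R * B z)%C).
{ exact (in_H_mult rho _ _ hrho (in_H_const rho (2 * s)%R hrho) HB). }
cbn [pe_sat ex_sat].
exists (exist _ _ (in_H_const rho (- (1))%C hrho)), (exist _ _ HX), (exist _ _ HV), (exist _ _ HA),
  (exist _ _ HB'), (exist _ _ (in_H_const rho (RtoC (/ (3 * IZR n + 1))) hrho)),
  (exist _ _ (in_H_const rho (RtoC (/ (3 * IZR n + 2))) hrho)).
apply int_formula_sat. intros z. unfold update. simpl. rewrite Hv. simpl.
destruct (E z) as [E1 E2].
set (P := fst (cheb d z)) in *. set (u := U z) in *. set (t := T z) in *.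
assert (Hsc : (s * s = 1)%C) by (rewrite <- RtoC_mult; now rewrite Hs).
rewrite RtoC_mult.
(* 3n + k is not divisible by 3, so the constants 3n + 1 and 3n + 2 are invertible. *)
assert (Hn0 : forall k : Z, (0 < k < 3)%Z -> 3 * IZR n + IZR k <> 0).
{ intros k Hk G. rewrite <- mult_IZR, <- plus_IZR in G. apply eq_IZR in G. lia. }
repeat split.
- transitivity (1 + 4 * (P * P - 1) * ((1 + (P * P - 1) * (u * u)) * (u * u)))%C; [ring|].
  rewrite <- E1.
  transitivity (1 + 4 * (P * P - 1) * (s * s) * (t * t * (u * u)))%C; [rewrite Hsc|]; ring.
- rewrite Hn, E2, RtoC_mult. ring.
- rewrite <- !RtoC_plus, <- RtoC_mult. f_equal. field. apply (Hn0 1%Z). lia.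
- rewrite <- !RtoC_plus, <- RtoC_mult. f_equal. field. apply (Hn0 2%Z). lia.
Qed.
End Satisfaction.

Theorem theorem1p1 (rho : R) (hrho : 0 <= rho) :
  pe_definable (H_struct rho hrho)
    (fun f => exists n : Z, f = int_in_H rho hrho n).
Proof.
(* [S k] is the least natural number exceeding rho; any larger degree would serve as well. *)
destruct (nfloor_ex rho hrho) as [k [_ Hk]].
assert (Hd : rho < INR (S k)) by (rewrite S_INR; exact Hk).
exists (Ex_prefix (1 :: 2 :: 3 :: 4 :: 5 :: 6 :: 7 :: nil)%nat (int_formula (S k))). split.
- intros x [Hx Hn]. apply int_formula_occurs in Hx.
  do 8 (destruct x as [|x]; [simpl in Hn; tauto|]). lia.
- intros v. split.
  + cbn [pe_sat ex_sat]. intros (e & X & V & A & B & a & b & H).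
    exact (int_formula_sound rho hrho _ _ Hd H).
  + intros [n Hn]. exact (int_formula_complete rho hrho _ v n Hn).
Qed.
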